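(* Let $\Phi=(\phi_1,\dots,\phi_K)$ be a unit norm tight frame in $\mathbb{R}^d$ with frame constant $A=K/d$ and coherence $\mu$. Let signals $y_n=\Phi x_n+r_n$, $n=1,\dots,N$, be i.i.d., where $r_n$ is independent of $x_n$ with $\|r_n\|_2\le\rho_{\max}$ a.s., $\mathbb{E}(r_n)=0$, $\mathbb{E}(r_nr_n^\star)=\rho^2I$, and $x_n$ is drawn from a symmetric probability distribution $\nu$ on $S^{K-1}$ with $\mathbb{E}_x\|x\|_\infty^2=\bar c_1^2$. Assume there is $\beta<1/2$ with $$\nu\Big(\frac{c_2(x)+\mu\|c(x)\|_1+\rho_{\max}}{c_1(x)-c_2(x)}\le\beta\Big)=1.$$ Let $\lambda:=\bar c_1^2-\frac{1-\bar c_1^2}{K-1}$ and $C_L:=(\sqrt A+\rho_{\max})^2$. If for some $0<q<1/4$ the number of samples satisfies $$N^{-q}+N^{-2q}/K\le\frac{(1-2\beta)^2}{4A\log(4AK/\lambda)},$$ then, except with probability $\exp\Big(\frac{-N^{1-4q}\lambda^2}{4K^2C_L}+Kd\log(NKC_L/\lambda)\Big)$, there is a local maximum $\tilde\Psi$ of $$\max_{\Psi\in\mathcal D}\frac1N\sum_{n=1}^N\|\Psi^\star y_n\|_\infty^2$$ (equivalently a local minimum of $\min_{\Psi\in\mathcal D,\,X\in\mathcal X_1}\|Y-\Psi X\|_F^2$) with $\max_k\|\tilde\psi_k-\phi_k\|_2\le2N^{-q}$.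
   Context: $\mathcal D$ is the set of dictionaries $\Psi=(\psi_1,\dots,\psi_K)$, $\psi_i\in\mathbb{R}^d$, $\|\psi_i\|_2=1$. $Y=(y_1,\dots,y_N)$, $\mathcal X_S$ is the set of $K\times N$ matrices whose columns each have at most $S$ nonzero entries, $\|\cdot\|_F$ the Frobenius norm. Unit norm tight frame with frame constant $A$: $\sum_i|\langle\phi_i,v\rangle|^2=A\|v\|_2^2$; coherence $\mu=\max_{i\ne j}|\langle\phi_i,\phi_j\rangle|$. Symmetric measure on $S^{K-1}$: invariant under coordinate sign flips and permutations. $c_1(x)\ge\dots\ge c_K(x)$ is the non-increasing rearrangement of $(|x_i|)_i$, $c(x)$ the resulting vector. *)

(* Defs.v *)
From HB Require Import structures.
From mathcomp Require Import all_boot all_order all_algebra all_fingroup.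
From mathcomp Require Import all_classical all_reals all_analysis.
Set Implicit Arguments. Unset Strict Implicit. Unset Printing Implicit Defensive.
Import Order.TTheory GRing.Theory Num.Theory.
Import numFieldNormedType.Exports.
Local Open Scope classical_set_scope.
Local Open Scope ring_scope.

Section Defs.
Variable R : realType.

Definition dotv n (u v : 'I_n -> R) : R := \sum_(i < n) u i * v i.
Definition norm2 n (v : 'I_n -> R) : R := Num.sqrt (\sum_(i < n) v i ^+ 2).
Definition normInf n (v : 'I_n -> R) : R := \big[Num.max/0]_(i < n) `|v i|.
Definition tvec n (t : n.-tuple R) : 'I_n -> R := fun i => tnth t i.

(* c(x): non-increasing rearrangement of (|x_i|)_i, as a sequence;
   c_k(x) (1-indexed) its k-th entry *)
Definition cvec n (x : 'I_n -> R) : seq R :=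
  sort (fun a b => b <= a) [seq `|x i| | i <- enum 'I_n].
Definition cc n (k : nat) (x : 'I_n -> R) : R := nth 0 (cvec x) k.-1.
Definition cnorm1 n (x : 'I_n -> R) : R := \sum_(a <- cvec x) `|a|.

Definition in_dict d K (Psi : 'I_K -> 'I_d -> R) : Prop :=
  forall k, norm2 (Psi k) = 1.

Definition unit_norm_tight_frame d K (Phi : 'I_K -> 'I_d -> R) (A : R) : Prop :=
  in_dict Phi /\
  forall v : 'I_d -> R, \sum_(k < K) (dotv (Phi k) v) ^+ 2 = A * norm2 v ^+ 2.

Definition coherence d K (Phi : 'I_K -> 'I_d -> R) : R :=
  \big[Num.max/0]_(ij : 'I_K * 'I_K | ij.1 != ij.2) `|dotv (Phi ij.1) (Phi ij.2)|.

Definition dict_dist d K (Psi Psi' : 'I_K -> 'I_d -> R) : R :=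
  \big[Num.max/0]_(k < K) norm2 (fun i => Psi k i - Psi' k i).

Definition Kobj d K N (Y : 'I_N -> 'I_d -> R) (Psi : 'I_K -> 'I_d -> R) : R :=
  N%:R^-1 * \sum_(n < N) normInf (fun k => dotv (Psi k) (Y n)) ^+ 2.

Definition local_max_dict d K N (Y : 'I_N -> 'I_d -> R) (Psi : 'I_K -> 'I_d -> R) : Prop :=
  in_dict Psi /\
  exists2 eps : R, 0 < eps &
    forall Psi', in_dict Psi' -> dict_dist Psi' Psi < eps -> Kobj Y Psi' <= Kobj Y Psi.

Definition symmetric_measure K (nu : set (K.-tuple R) -> \bar R) : Prop :=
  forall (s : 'I_K -> bool) (sigma : 'S_K) (B : set (K.-tuple R)), measurable B ->
    nu ((fun x : K.-tuple R =>
          [tuple (if s i then -1 else 1) * tnth x (sigma i) | i < K]) @^-1` B) = nu B.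
End Defs.

Section Indep.
Context {R : realType} {d0 : measure_display} {Omega : measurableType d0}.
Context {d1 d2 : measure_display} {T1 : measurableType d1} {T2 : measurableType d2}.

Definition indep2 (P : probability Omega R) (X : Omega -> T1) (Y : Omega -> T2) : Prop :=
  forall A B, measurable A -> measurable B ->
    P (X @^-1` A `&` Y @^-1` B) = (P (X @^-1` A) * P (Y @^-1` B))%E.

Definition mutually_indep (P : probability Omega R) I (Z : 'I_I -> Omega -> T1) : Prop :=
  forall A : 'I_I -> set T1, (forall i, measurable (A i)) ->
    P (\bigcap_(i in [set: 'I_I]) (Z i @^-1` A i)) = (\prod_(i < I) P (Z i @^-1` A i))%E.

Definition ident_distr (P : probability Omega R) I (Z : 'I_I -> Omega -> T1) : Prop :=
  forall i j A, measurable A -> P (Z i @^-1` A) = P (Z j @^-1` A).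
End Indep.

(* Main.v *)
Require Import Defs.
From HB Require Import structures.
From mathcomp Require Import all_boot all_order all_algebra all_fingroup.
From mathcomp Require Import all_classical all_reals all_analysis.
From mathcomp Require Import measurable_realfun ring lra.
Import Order.TTheory GRing.Theory Num.Theory.
Import numFieldNormedType.Exports.
Local Open Scope classical_set_scope.
Local Open Scope ring_scope.

(** The gap condition makes the index of the largest [|<psi_k, y_n>|] constant
    for all dictionaries [Psi] within distance
    [e = 8 N^(-2q) / sqrt (K C_L) <= 2 N^(-q)] of [Phi], since almost surely
    [c_1 - c_2 >= (2 / 3) c_1 >= 2 / (3 sqrt K)].  On this ball the objective is
    therefore a sum of quadratic forms [psi_k^T M_k psi_k], where [M_k] is the
    empirical second moment matrix of the signals dominated by the k-th
    coefficient.  Symmetry of the coefficients and tightness of the frame give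
    [E M_k = (lambda / K) phi_k phi_k^T + s I].  If the entries of [M_k - E M_k]
    along [phi_k] and the projections [u_a] of the standard basis onto its
    orthogonal complement are small, [psi^T M_k psi] is smaller on the boundary
    of the cap of radius [e] around [phi_k] than at its centre, so that its
    maximum over the cap is an interior, hence local, maximum.

    A Bernstein inequality bounds the entries.  The second moments of
    [<u_a, y>] are of order [A / K^2], which makes up for the small radius [e]:
    a union bound over the [K (d + 1)^2] entries suffices and no net of
    dictionaries is needed. *)

Set Implicit Arguments. Unset Strict Implicit. Unset Printing Implicit Defensive.

(** * Vectors and maxima over caps *)

(** The radius [e] is squeezed from two sides, with [C = sqrt A + rho_max] and [p = N^(-q)].
    Freezing all labels requires [3 e C sqrt K <= 1 - 2 beta]. The choice of [e] turns the left side
    into [24 p^2], and the sample size condition supplies [p <= (1 - 2 beta)^2 / 6]. In the other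
    direction, the deviation on the boundary of a cap has a term linear in [e], while the curvature
    gain is only quadratic in [e]. The mixed entries, along [phi_k] and [u_a], must therefore be
    accurate to order [e lambda / (K sqrt d)]. Squared in a Bernstein exponent, this produces [p^4],
    hence [N^(1 - 4q)], and the factor 8 in [e] makes the exponent large enough. The variance of
    these entries is of order [A / K^2] because the gap bounds [<phi_k, y>] by [3/2], independently
    of [A], and also forces [rho_max <= 1/2] and mean square at most [1/K] for the coefficients that
    are not dominant. The case [K = 1], where [lambda] divides by zero, is treated apart. *)

Section Vectors.
Context {R : realType} {d : nat}.
Implicit Types u v w : 'I_d -> R.

Lemma dotvC u v : dotv u v = dotv v u.
Proof. by apply: eq_bigr => i _; rewrite mulrC. Qed.

Lemma dotvDl u v w : dotv (fun i => u i + v i) w = dotv u w + dotv v w.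
Proof. by rewrite /dotv -big_split; apply: eq_bigr => i _; rewrite mulrDl. Qed.

Lemma dotvZl a u v : dotv (fun i => a * u i) v = a * dotv u v.
Proof. by rewrite /dotv mulr_sumr; apply: eq_bigr => i _; rewrite mulrA. Qed.

Lemma dotvBl u v w : dotv (fun i => u i - v i) w = dotv u w - dotv v w.
Proof. by rewrite /dotv -sumrB; apply: eq_bigr => i _; rewrite mulrBl. Qed.

Lemma dotvDr u v w : dotv w (fun i => u i + v i) = dotv w u + dotv w v.
Proof. by rewrite dotvC dotvDl !(dotvC w). Qed.

Lemma dotvBr u v w : dotv w (fun i => u i - v i) = dotv w u - dotv w v.
Proof. by rewrite dotvC dotvBl !(dotvC w). Qed.

Lemma dotvZr a u v : dotv v (fun i => a * u i) = a * dotv v u.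
Proof. by rewrite dotvC dotvZl (dotvC v). Qed.

Lemma dotv_suml (I : finType) (c : I -> R) (e : I -> 'I_d -> R) v :
  dotv (fun i => \sum_j c j * e j i) v = \sum_j c j * dotv (e j) v.
Proof.
rewrite /dotv; under eq_bigr do rewrite mulr_suml.
rewrite exchange_big; apply: eq_bigr => j _ /=.
by rewrite mulr_sumr; apply: eq_bigr => i _; rewrite mulrA.
Qed.

Lemma dotvv_ge0 u : 0 <= dotv u u.
Proof. by apply: sumr_ge0 => i _; rewrite -expr2 sqr_ge0. Qed.

Lemma norm2_ge0 u : 0 <= norm2 u.
Proof. exact: sqrtr_ge0. Qed.

Lemma norm2E u : norm2 u = Num.sqrt (dotv u u).
Proof. by rewrite /norm2 /dotv; under eq_bigr do rewrite expr2. Qed.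

Lemma sqr_norm2 u : norm2 u ^+ 2 = dotv u u.
Proof. by rewrite norm2E sqr_sqrtr ?dotvv_ge0. Qed.

Lemma sqr_dotv_le u v : dotv u v ^+ 2 <= dotv u u * dotv v v.
Proof.
have [v0|v0] := eqVneq (dotv v v) 0.
  have vi i : v i = 0.
    move/eqP: v0; rewrite /dotv psumr_eq0 => [/allP /(_ i)|j _].
      by rewrite mem_index_enum => /(_ isT); rewrite mulf_eq0 orbb => /eqP.
    by rewrite -expr2 sqr_ge0.
  rewrite v0 mulr0 {1}/dotv big1 ?expr0n// => i _.
  by rewrite vi mulr0.
have v_gt0 : 0 < dotv v v by rewrite lt_neqAle eq_sym v0 dotvv_ge0.
have := dotvv_ge0 (fun i => dotv v v * u i - dotv u v * v i).
rewrite dotvBl !dotvBr !dotvZl !dotvZr (dotvC v u) => H.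
rewrite -subr_ge0 -(pmulr_rge0 _ v_gt0).
by apply: le_trans H _; rewrite le_eqVlt; apply/orP; left; apply/eqP; ring.
Qed.

Lemma abs_dotv_le u v : `|dotv u v| <= norm2 u * norm2 v.
Proof.
rewrite -(@ler_pXn2r _ 2) ?nnegrE ?mulr_ge0 ?norm2_ge0//.
by rewrite exprMn !sqr_norm2 real_normK ?num_real ?sqr_dotv_le.
Qed.

Lemma norm2_triangle u v : norm2 (fun i => u i + v i) <= norm2 u + norm2 v.
Proof.
rewrite -(@ler_pXn2r _ 2) ?nnegrE ?addr_ge0 ?norm2_ge0//.
rewrite sqr_norm2 dotvDl !dotvDr sqrrD !sqr_norm2 (dotvC v u).
have := le_trans (ler_norm _) (abs_dotv_le u v); rewrite mulr2n; lra.
Qed.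

Lemma norm2_triangleB u v w :
  norm2 (fun i => u i - w i) <=
  norm2 (fun i => u i - v i) + norm2 (fun i => v i - w i).
Proof.
apply: le_trans (norm2_triangle _ _).
rewrite le_eqVlt; apply/orP; left; apply/eqP; congr norm2.
by apply/funext => i; ring.
Qed.

Lemma norm2_subxx u : norm2 (fun i => u i - u i) = 0.
Proof. by rewrite /norm2 big1 ?sqrtr0// => i _; rewrite subrr expr0n. Qed.

Lemma abs_coord_le u i : `|u i| <= norm2 u.
Proof.
rewrite -(@ler_pXn2r _ 2) ?nnegrE ?norm2_ge0// real_normK ?num_real//.
rewrite sqr_norm2 /dotv (bigD1 i) //= -expr2 lerDl.
by apply: sumr_ge0 => j _; rewrite -expr2 sqr_ge0.
Qed.

Lemma sum_abs_le u : (\sum_i `|u i|) ^+ 2 <= d%:R * dotv u u.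
Proof.
have := sqr_dotv_le (fun=> 1) (fun i => `|u i|).
rewrite /dotv; under eq_bigr do rewrite mul1r.
under [X in _ <= X * _]eq_bigr do rewrite mul1r.
rewrite sumr_const card_ord.
by under [X in _ <= _ * X]eq_bigr do rewrite -expr2 real_normK ?num_real// expr2.
Qed.

End Vectors.

Section FiniteMax.
Context {R : realType}.

Lemma bigmax_le_iff (I : finType) (F : I -> R) (a : R) (P : pred I) : 0 <= a ->
  \big[Num.max/0]_(i | P i) F i <= a <-> (forall i, P i -> F i <= a).
Proof.
move=> a0; split => [H i Pi|H].
  exact: le_trans (le_bigmax_cond 0 F Pi) H.
by apply/bigmax_leP; split.
Qed.

Lemma dict_dist_le d K (Psi Phi : 'I_K -> 'I_d -> R) e : 0 <= e ->
  dict_dist Psi Phi <= e <->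
  (forall k, norm2 (fun i => Psi k i - Phi k i) <= e).
Proof.
move=> e0; rewrite /dict_dist bigmax_le_iff//; split=> H k; last by move=> _.
exact: H.
Qed.

Lemma normInf_at n (v : 'I_n -> R) k :
  (forall j, `|v j| <= `|v k|) -> normInf v = `|v k|.
Proof.
move=> H; apply/eqP; rewrite eq_le; apply/andP; split.
  by apply/bigmax_leP; split.
exact: le_bigmax.
Qed.

End FiniteMax.

Section CapMaximum.
Context {R : realType} {d : nat}.

Lemma continuous_sumr (T : topologicalType) (I : finType) (F : I -> T -> R) :
  (forall i, continuous (F i)) -> continuous (fun x => \sum_i F i x).
Proof. by move=> cF; apply: continuous_big => [|i _]; [exact: add_continuous|exact: cF]. Qed.

Lemma continuous_mulr (T : topologicalType) (f g : T -> R) :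
  continuous f -> continuous g -> continuous (fun x => f x * g x).
Proof. by move=> cf cg x; apply: (@cvgM R _ (nbhs x)); [exact: cf|exact: cg]. Qed.

Lemma continuous_quadratic N (c : 'I_N -> R) (Y : 'I_N -> 'I_d -> R) :
  continuous (fun z : 'rV[R]_d => \sum_n c n * dotv (z ord0) (Y n) ^+ 2).
Proof.
have cd (y : 'I_d -> R) : continuous (fun z : 'rV[R]_d => dotv (z ord0) y).
  apply: continuous_sumr => i; apply: continuous_mulr; last exact: cst_continuous.
  exact: coord_continuous.
apply: continuous_sumr => n; apply: continuous_mulr; first exact: cst_continuous.
by apply: continuous_mulr; exact: cd.
Qed.

Lemma quadratic_argmax_cap N (c : 'I_N -> R) (Y : 'I_N -> 'I_d -> R)
    (phi : 'I_d -> R) e : norm2 phi = 1 -> 0 <= e ->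
  exists psi : 'I_d -> R,
    [/\ norm2 psi = 1, norm2 (fun i => psi i - phi i) <= e &
        forall psi', norm2 psi' = 1 -> norm2 (fun i => psi' i - phi i) <= e ->
          \sum_n c n * dotv psi' (Y n) ^+ 2 <= \sum_n c n * dotv psi (Y n) ^+ 2].
Proof.
move=> phi1 e0.
(* Row vectors are used for their topology, in which the cube [[-1, 1]^d] is compact; the cap is a
   closed subset of it. *)
pose S := [set z : 'rV[R]_d | norm2 (z ord0) = 1 /\
                              norm2 (fun i => z ord0 i - phi i) <= e].
have rowE (v : 'I_d -> R) : (\row_i v i) ord0 = v.
  by apply/funext => i; rewrite mxE.
have cn (v : 'I_d -> R) :
    continuous (fun z : 'rV[R]_d => norm2 (fun i => z ord0 i - v i)).
  move=> z; apply: (@continuous_comp _ _ _ (fun z : 'rV[R]_d =>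
    \sum_i (z ord0 i - v i) ^+ 2) Num.sqrt); last exact: sqrt_continuous.
  have ci i : continuous (fun z : 'rV[R]_d => z ord0 i - v i).
    by move=> {}z; apply: (@cvgB _ _ _ (nbhs z)); [exact: coord_continuous|exact: cvg_cst].
  by apply: continuous_sumr => i; apply: continuous_mulr; exact: ci.
have n0 : (fun z : 'rV[R]_d => norm2 (z ord0)) =
    (fun z : 'rV[R]_d => norm2 (fun i => z ord0 i - 0)).
  by apply/funext => z; congr norm2; apply/funext => i; rewrite subr0.
have S0 : S !=set0.
  by exists (\row_i phi i); rewrite /S /= rowE phi1 norm2_subxx.
have cS : compact S.
  have cb : compact [set v : 'rV[R]_d | forall i, `[(-1 : R), 1]%classic (v ord0 i)].
    by apply: (@rV_compact _ d (fun=> `[(-1 : R), 1]%classic)) => i; exact: segment_compact.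
  apply: subclosed_compact cb _ => [|z [z1 _] i] /=; last first.
    by rewrite in_itv /= -ler_norml -z1 abs_coord_le.
  rewrite (_ : S = ((fun z : 'rV[R]_d => norm2 (z ord0)) @^-1` [set 1]) `&`
    ((fun z : 'rV[R]_d => norm2 (fun i => z ord0 i - phi i)) @^-1`
      [set t | t <= e])) //.
  apply: closedI; apply: preimage_closed.
  - by move=> z _; rewrite n0; exact: cn.
  - exact: closed_eq.
  - by move=> z _; exact: cn.
  - exact: closed_le.
have [z /set_mem [z1 ze] zmax] := compact_EVT_max S0 cS
  (continuous_subspaceT (@continuous_quadratic N c Y)).
exists (z ord0); split=> // psi' p1 pe.
have := zmax (\row_i psi' i); rewrite /= rowE; apply.
by apply/mem_set; rewrite /S /= rowE.
Qed.

End CapMaximum.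

(** * Deviation of quadratic forms and local maxima *)

Section BilinearDeviation.
Context {R : realType} {d : nat}.
Implicit Types u v w : 'I_d -> R.

(* For a unit vector [phi], the projection of the a-th basis vector onto the
   orthogonal complement of [phi]. *)
Definition perp_basis (phi : 'I_d -> R) (a : 'I_d) : 'I_d -> R :=
  fun i => (i == a)%:R - phi a * phi i.

Lemma dotv_perp_basis phi a v :
  dotv (perp_basis phi a) v = v a - phi a * dotv phi v.
Proof.
rewrite /perp_basis dotvBl dotvZl; congr (_ - _).
rewrite /dotv (bigD1 a) //= eqxx mul1r big1 ?addr0// => i /negbTE ->.
by rewrite mul0r.
Qed.

Lemma perp_basis_orth phi a : norm2 phi = 1 -> dotv (perp_basis phi a) phi = 0.
Proof. by move=> h; rewrite dotv_perp_basis -sqr_norm2 h; ring. Qed.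

Lemma dotvv_perp_basis phi a : norm2 phi = 1 ->
  dotv (perp_basis phi a) (perp_basis phi a) = 1 - phi a ^+ 2.
Proof.
move=> h; rewrite dotv_perp_basis (dotvC phi) perp_basis_orth// /perp_basis eqxx.
by rewrite mulr0 subr0 expr2.
Qed.

Lemma norm2_perp_basis phi a : norm2 phi = 1 -> norm2 (perp_basis phi a) <= 1.
Proof.
move=> h; rewrite norm2E dotvv_perp_basis// -[leRHS]sqrtr1 ler_wsqrtr//.
by rewrite gerBl sqr_ge0.
Qed.

(** The sum is the projection of [psi - c phi] onto the orthogonal complement of [phi], where this
    vector already lies. Using an overcomplete system avoids choosing an orthonormal basis of the
    complement. *)
Lemma perp_basis_decomp phi psi : norm2 phi = 1 ->
  psi = fun i => dotv psi phi * phi i +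
    \sum_a (psi a - dotv psi phi * phi a) * perp_basis phi a i.
Proof.
move=> h; apply/funext => i; set c := dotv psi phi.
rewrite /perp_basis; under eq_bigr do rewrite mulrBr.
rewrite sumrB (bigD1 i) //= eqxx mulr1 big1 ?addr0 => [|a]; last first.
  by rewrite eq_sym => /negbTE ->; rewrite mulr0.
under eq_bigr do rewrite mulrA.
rewrite -mulr_suml (_ : \sum_j _ = 0); last first.
  under eq_bigr do rewrite mulrBl -mulrA.
  by rewrite sumrB -mulr_sumr -/(dotv phi phi) -sqr_norm2 h expr1n mulr1 subrr.
by rewrite mul0r; ring.
Qed.

Variable D : ('I_d -> R) -> ('I_d -> R) -> R.
Hypothesis D_lin : forall a u v w,
  D (fun i => a * u i + v i) w = a * D u w + D v w.
Hypothesis D_sym : forall u v, D u v = D v u.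

Lemma bilin0 w : D (fun=> 0) w = 0.
Proof.
have := D_lin 1 (fun=> 0) (fun=> 0) w.
rewrite (_ : (fun _ => _) = fun=> 0) => [|]; first by lra.
by apply/funext => i; rewrite mulr0 addr0.
Qed.

Lemma bilin_sum (I : finType) (c : I -> R) (e : I -> 'I_d -> R) w :
  D (fun i => \sum_j c j * e j i) w = \sum_j c j * D (e j) w.
Proof.
elim: (index_enum I) => [|j s IH].
  by rewrite big_nil -[RHS](bilin0 w); congr D; apply/funext => i; rewrite big_nil.
rewrite big_cons -IH -D_lin; congr D.
by apply/funext => i; rewrite big_cons.
Qed.

(** With [psi = c phi + z] and [z] orthogonal to [phi], one has [|z|^2 = h], and the difference is
    [-h D(phi, phi) + 2 c D(z, phi) + D(z, z)]. The coefficients of [z] have l1 norm at most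
    [sqrt (h d)], which enters once in the second term and twice in the third. *)
Lemma bilin_deviation phi psi (t1 t2 t3 : R) : norm2 phi = 1 -> norm2 psi = 1 ->
  0 <= t1 -> 0 <= t2 ->
  `|D phi phi| <= t3 ->
  (forall a, `|D phi (perp_basis phi a)| <= t1) ->
  (forall a b, `|D (perp_basis phi a) (perp_basis phi b)| <= t2) ->
  let h := 1 - dotv psi phi ^+ 2 in
  D psi psi - D phi phi <= h * t3 + 2 * Num.sqrt h * Num.sqrt d%:R * t1
                           + h * d%:R * t2.
Proof.
move=> phi1 psi1 t10 t20 H3 H1 H2; set c := dotv psi phi; cbv zeta.
set h := 1 - c ^+ 2.
pose v := fun a => psi a - c * phi a.
pose z := fun i => \sum_a v a * perp_basis phi a i.
have psiE : psi = fun i => c * phi i + z i by exact: perp_basis_decomp.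
have vv : dotv v v = h.
  rewrite /v dotvBl !dotvBr !dotvZl !dotvZr -!sqr_norm2 phi1 psi1.
  by rewrite (dotvC phi) -/c /h; ring.
have h0 : 0 <= h by rewrite -vv dotvv_ge0.
have c1 : c ^+ 2 <= 1 by rewrite -subr_ge0.
have DE : D psi psi = c ^+ 2 * D phi phi + 2 * c * D z phi + D z z.
  have Dl w : D psi w = c * D phi w + D z w by rewrite {1}psiE D_lin.
  by rewrite Dl (D_sym phi psi) (D_sym z psi) !Dl (D_sym phi z); ring.
have sv : \sum_a `|v a| <= Num.sqrt h * Num.sqrt d%:R.
  rewrite -(@ler_pXn2r _ 2) ?nnegrE ?mulr_ge0 ?sqrtr_ge0 ?sumr_ge0//.
  by rewrite exprMn !sqr_sqrtr// -vv mulrC sum_abs_le.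
have sv0 : 0 <= \sum_a `|v a| by rewrite sumr_ge0.
have Dz : `|D z phi| <= (Num.sqrt h * Num.sqrt d%:R) * t1.
  rewrite /z bilin_sum; apply: le_trans (ler_norm_sum _ _ _) _.
  apply: (@le_trans _ _ ((\sum_a `|v a|) * t1)); last exact: ler_wpM2r.
  rewrite mulr_suml; apply: ler_sum => a _; rewrite normrM D_sym.
  exact: ler_wpM2l.
have Dzz : `|D z z| <= (Num.sqrt h * Num.sqrt d%:R) ^+ 2 * t2.
  rewrite {1}/z bilin_sum; apply: le_trans (ler_norm_sum _ _ _) _.
  apply: (@le_trans _ _ ((\sum_a `|v a|) ^+ 2 * t2)); last first.
    by apply: ler_wpM2r => //; rewrite ler_pXn2r ?nnegrE ?mulr_ge0 ?sqrtr_ge0.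
  rewrite expr2 -mulrA [X in _ <= X]mulr_suml; apply: ler_sum => a _.
  rewrite normrM; apply: ler_wpM2l => //.
  rewrite D_sym /z bilin_sum; apply: le_trans (ler_norm_sum _ _ _) _.
  rewrite mulr_suml; apply: ler_sum => b _; rewrite normrM; exact: ler_wpM2l.
have -> : D psi psi - D phi phi = - h * D phi phi + 2 * c * D z phi + D z z.
  by rewrite DE /h; ring.
have e1 : - h * D phi phi <= h * t3.
  rewrite mulNr -mulrN ler_wpM2l//; apply: le_trans H3.
  by rewrite -normrN ler_norm.
have e2 : 2 * c * D z phi <= 2 * Num.sqrt h * Num.sqrt d%:R * t1.
  have : `|c * D z phi| <= Num.sqrt h * Num.sqrt d%:R * t1.
    rewrite normrM -[leRHS]mul1r ler_pM//.
    by rewrite -(@ler_pXn2r _ 2) ?nnegrE// real_normK ?num_real// expr1n.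
  by move=> /(le_trans (ler_norm _)); lra.
have e3 : D z z <= h * d%:R * t2.
  apply: le_trans (ler_norm _) _.
  by move: Dzz; rewrite exprMn !sqr_sqrtr.
by rewrite !lerD.
Qed.

End BilinearDeviation.

Section LocalMaximum.
Context {R : realType} {d K N : nat}.

(** Once the labels are frozen the objective splits into one function per atom, so each atom can be
    maximized over its own cap. The strict inequality keeps the maximizers off the boundaries. *)
Lemma local_max_of_stable (Y : 'I_N -> 'I_d -> R) (Phi : 'I_K -> 'I_d -> R)
    (lab : 'I_N -> 'I_K) (e : R) : 0 < e -> in_dict Phi ->
  (forall Psi, in_dict Psi -> dict_dist Psi Phi <= e ->
    forall n j, `|dotv (Psi j) (Y n)| <= `|dotv (Psi (lab n)) (Y n)|) ->
  (forall k psi, norm2 psi = 1 -> norm2 (fun i => psi i - Phi k i) = e ->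
    \sum_n (lab n == k)%:R * dotv psi (Y n) ^+ 2 <
    \sum_n (lab n == k)%:R * dotv (Phi k) (Y n) ^+ 2) ->
  exists Psi, local_max_dict Y Psi /\ dict_dist Psi Phi <= e.
Proof.
move=> e0 Phi1 stab bnd; have e0' := ltW e0.
pose Q k psi := \sum_n (lab n == k)%:R * dotv psi (Y n) ^+ 2.
have KobjE Psi : in_dict Psi -> dict_dist Psi Phi <= e ->
    Kobj Y Psi = N%:R^-1 * \sum_k Q k (Psi k).
  move=> P1 Pe; congr (_ * _); rewrite /Q exchange_big; apply: eq_bigr => n _ /=.
  rewrite (@normInf_at _ _ _ (lab n)); last by move=> j; apply: stab.
  rewrite real_normK ?num_real// (bigD1 (lab n)) //= eqxx mul1r.
  by rewrite big1 ?addr0// => k /negbTE; rewrite eq_sym => ->; rewrite mul0r.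
have /choice[Psi PsiP] k := quadratic_argmax_cap (fun n => (lab n == k)%:R) Y
  (Phi1 k) e0'.
have PsiD : in_dict Psi by move=> k; case: (PsiP k).
have Psie : dict_dist Psi Phi <= e.
  by apply/dict_dist_le => // k; case: (PsiP k).
have Psilt k : norm2 (fun i => Psi k i - Phi k i) < e.
  have [p1 pe pmax] := PsiP k; rewrite lt_neqAle pe andbT; apply/eqP => pE.
  have := bnd k _ p1 pE; rewrite ltNge pmax ?norm2_subxx//; exact: Phi1.
exists Psi; split=> //; split=> //.
(* The least distance left to the boundary of a cap: a dictionary closer than this to [Psi] stays in
   every cap. *)
pose del := \big[Num.min/e]_k (e - norm2 (fun i => Psi k i - Phi k i)).
have del0 : 0 < del.
  by apply/bigmin_gtP; split => // k _; rewrite subr_gt0.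
exists del => // Psi' P1 Pd.
have Pe : dict_dist Psi' Phi <= e.
  apply/dict_dist_le => // k.
  apply: le_trans (norm2_triangleB _ (Psi k) _) _.
  have : norm2 (fun i => Psi' k i - Psi k i) <= del.
    by have /dict_dist_le := ltW Pd; apply; exact: ltW.
  have : del <= e - norm2 (fun i => Psi k i - Phi k i).
    exact: bigmin_le.
  lra.
rewrite !KobjE// ler_wpM2l ?invr_ge0//; apply: ler_sum => k _.
have [_ _] := PsiP k; apply; first exact: P1.
by have /dict_dist_le := Pe; apply.
Qed.

End LocalMaximum.

(** * Gapped coefficients and stability of the maximal index *)

Section Gap.
Context {R : realType} {K : nat}.
Implicit Types (x : 'I_K -> R) (k : 'I_K).

(** The gap condition, imposed on every competitor [j] of the top index [k]. Without the sorted
    vector, measurability and invariance under signed permutations are direct. *)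
Definition gapped (mu rho beta : R) x k : Prop :=
  forall j, j != k -> `|x j| < `|x k| /\
    `|x j| + mu * \sum_i `|x i| + rho <= beta * (`|x k| - `|x j|).

Lemma cnorm1E x : cnorm1 x = \sum_i `|x i|.
Proof.
rewrite /cnorm1 (perm_big [seq `|x i| | i <- enum 'I_K]) /=; last first.
  by rewrite /cvec perm_sort.
by rewrite big_map big_enum /=; apply: eq_bigr => i _; rewrite normr_id.
Qed.

Lemma ccE x : (1 < K)%N -> exists i0 i1 : 'I_K,
  [/\ i0 != i1, cc 1 x = `|x i0|, cc 2 x = `|x i1|, `|x i1| <= `|x i0| &
      forall j, j != i0 -> `|x j| <= `|x i1|].
Proof.
move=> K1; pose leT : rel 'I_K := relpre (fun i => `|x i|) (fun a b => b <= a).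
pose s := sort leT (enum 'I_K).
have cs : cvec x = [seq `|x i| | i <- s] by rewrite /cvec sort_map.
have leT_tr : transitive leT by move=> b a c /= h1 h2; exact: le_trans h2 h1.
have srt : sorted leT s.
  by apply: sort_sorted => a b /=; rewrite le_total.
have us : uniq s by rewrite sort_uniq enum_uniq.
have ms i : i \in s by rewrite mem_sort mem_enum.
have sz : size s = K by rewrite size_sort size_enum_ord.
move: srt us ms sz cs; case: s => [|i0 [|i1 s]] /=.
- by move=> _ _ _ K0 _; exfalso; move: K1; rewrite -K0.
- by move=> _ _ _ K0 _; exfalso; move: K1; rewrite -K0.
move=> /andP[i01 srt] /andP[+ us] ms _ cs; rewrite inE negb_or => /andP[n01 _].
exists i0, i1; rewrite /cc cs; split=> // j jn.
have := ms j; rewrite !inE (negbTE jn) /= => /orP[/eqP->//|js].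
by have /allP/(_ _ js) := order_path_min leT_tr srt.
Qed.

(** The runner-up is the worst competitor: a larger [|x_j|] raises the left side and lowers the
    right side, as [beta >= 0]. The latter follows from the nonnegative numerator. *)
Lemma cc_gapP mu rho beta x : (1 < K)%N -> 0 <= mu -> 0 <= rho ->
  (0 < cc 1 x - cc 2 x /\
   (cc 2 x + mu * cnorm1 x + rho) / (cc 1 x - cc 2 x) <= beta) <->
  exists k, gapped mu rho beta x k.
Proof.
move=> K1 mu0 rho0; have [i0 [i1 [n01 -> -> le10 le1]]] := ccE x K1; rewrite cnorm1E.
split=> [[d0]|[k gk]].
  rewrite ler_pdivrMr// => H; exists i0 => j jn; have lj := le1 j jn.
  split; first by lra.
  have s0 : 0 <= mu * \sum_i `|x i| by rewrite mulr_ge0 ?sumr_ge0.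
  have b0 : 0 <= beta.
    rewrite -(pmulr_lge0 _ d0); apply: le_trans H.
    by rewrite !addr_ge0.
  have : beta * (`|x i0| - `|x i1|) <= beta * (`|x i0| - `|x j|).
    by apply: ler_wpM2l; lra.
  by lra.
have k0 : k = i0.
  apply/eqP/negP => /negP kn; have kn' : i0 != k by rewrite eq_sym.
  have [+ _] := gk i0 kn'; by have := le1 k kn; lra.
subst k; have n10 : i1 != i0 by rewrite eq_sym.
have [lt1 H] := gk i1 n10.
split; first by lra.
by rewrite ler_pdivrMr//; lra.
Qed.

Lemma gapped_le mu rho beta x k : gapped mu rho beta x k ->
  forall j, `|x j| <= `|x k|.
Proof.
move=> g j; have [->//|jk] := eqVneq j k; by have [/ltW] := g j jk.
Qed.

Lemma gapped_inj mu rho beta x k k' :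
  gapped mu rho beta x k -> gapped mu rho beta x k' -> k = k'.
Proof.
move=> g g'; apply/eqP/negP => /negP kk'.
have [] := g' _ kk'; have := gapped_le g k'; by lra.
Qed.

Lemma normInf_gapped mu rho beta x k :
  gapped mu rho beta x k -> normInf x = `|x k|.
Proof. by move=> g; apply: normInf_at; exact: gapped_le g. Qed.

Lemma gapped_large mu rho beta x k : gapped mu rho beta x k ->
  norm2 x = 1 -> 1 <= K%:R * `|x k| ^+ 2.
Proof.
move=> g x1; rewrite -[leLHS](expr1n R 2) -[X in X ^+ 2 <= _]x1 sqr_norm2 /dotv.
have -> : K%:R * `|x k| ^+ 2 = \sum_(i < K) `|x k| ^+ 2.
  by rewrite sumr_const card_ord mulr_natl.
apply: ler_sum => i _.
by rewrite -expr2 -real_normK ?num_real// ler_pXn2r ?nnegrE// (gapped_le g).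
Qed.

(** Dropping the nonnegative l1 and noise terms leaves [|x_j| <= (|x_k| - |x_j|) / 2]. *)
Lemma gapped_ratio mu rho beta x k j : gapped mu rho beta x k ->
  0 <= mu -> 0 <= rho -> beta < 1 / 2 -> j != k -> 3 * `|x j| <= `|x k|.
Proof.
move=> g mu0 rho0 b jk; have [l H] := g j jk.
have s0 : 0 <= mu * \sum_i `|x i| by rewrite mulr_ge0 ?sumr_ge0.
have : beta * (`|x k| - `|x j|) <= 1 / 2 * (`|x k| - `|x j|).
  by rewrite ler_wpM2r; lra.
lra.
Qed.

End Gap.

Section Signals.
Context {R : realType} {d K : nat} (Phi : 'I_K -> 'I_d -> R).
Implicit Types (x : 'I_K -> R) (r : 'I_d -> R).

Definition signal x r : 'I_d -> R := fun i => \sum_k x k * Phi k i + r i.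

Lemma dotv_signal u x r :
  dotv u (signal x r) = \sum_k x k * dotv u (Phi k) + dotv u r.
Proof.
rewrite dotvC /signal dotvDl dotv_suml (dotvC r); congr (_ + _).
by apply: eq_bigr => k _; rewrite dotvC.
Qed.

Lemma coherence_ge0 : 0 <= coherence Phi.
Proof. exact: bigmax_ge_id. Qed.

Lemma coherence_ge i j : i != j -> `|dotv (Phi i) (Phi j)| <= coherence Phi.
Proof.
move=> ij; pose F (p : 'I_K * 'I_K) := `|dotv (Phi p.1) (Phi p.2)|.
exact: (le_bigmax_cond 0 F (ij : (fun p : 'I_K * 'I_K => p.1 != p.2) (i, j))).
Qed.

Lemma dotv_atom_signal x r k : in_dict Phi ->
  `|dotv (Phi k) (signal x r) - x k| <=
  coherence Phi * \sum_i `|x i| + norm2 r.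
Proof.
move=> P1; rewrite dotv_signal (bigD1 k) //= -sqr_norm2 P1 expr1n mulr1.
rewrite [X in `|X|](_ : _ = \sum_(i | i != k) x i * dotv (Phi k) (Phi i)
   + dotv (Phi k) r); last by ring.
apply: le_trans (ler_normD _ _) _; apply: lerD; last first.
  by apply: le_trans (abs_dotv_le _ _) _; rewrite P1 mul1r.
apply: le_trans (ler_norm_sum _ _ _) _.
rewrite mulr_sumr [leRHS](bigD1 k) //= ler_wpDl ?mulr_ge0 ?coherence_ge0//.
apply: ler_sum => i ik; rewrite normrM mulrC ler_wpM2r// coherence_ge//.
by rewrite eq_sym.
Qed.

(** Duality: for [y = Phi x], [|y|^2 = <x, Phi^T y> <= |x| |Phi^T y| = |x| sqrt A |y|] by
    tightness. *)
Lemma norm2_synthesis (A : R) x : 0 <= A -> unit_norm_tight_frame Phi A ->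
  norm2 (fun i => \sum_k x k * Phi k i) <= Num.sqrt A * norm2 x.
Proof.
move=> A0 [P1 tf]; set y := fun i => _.
have [y0|y0] := eqVneq (norm2 y) 0; first by rewrite y0 mulr_ge0 ?sqrtr_ge0.
have yp : 0 < norm2 y by rewrite lt_neqAle eq_sym y0 norm2_ge0.
rewrite -(ler_pM2r yp) -expr2 sqr_norm2 {1}/y dotv_suml.
rewrite -[leLHS]/(dotv x (fun k => dotv (Phi k) y)).
have := abs_dotv_le x (fun k => dotv (Phi k) y); rewrite (norm2E (fun k : 'I_K => dotv (Phi k) y)).
have -> : dotv (fun k => dotv (Phi k) y) (fun k => dotv (Phi k) y) =
    A * norm2 y ^+ 2.
  by rewrite -tf; apply: eq_bigr => k _; rewrite expr2.
rewrite sqrtrM// sqrtr_sqr (ger0_norm (norm2_ge0 y)) => H.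
apply: le_trans (le_trans (ler_norm _) H) _.
by rewrite le_eqVlt; apply/orP; left; apply/eqP; ring.
Qed.

Lemma norm2_signal (A rho : R) x r : 0 <= A -> unit_norm_tight_frame Phi A ->
  norm2 x = 1 -> norm2 r <= rho -> norm2 (signal x r) <= Num.sqrt A + rho.
Proof.
move=> A0 tf x1 rr; apply: le_trans (norm2_triangle _ _) _.
by apply: lerD => //; have := norm2_synthesis x A0 tf; rewrite x1 mulr1.
Qed.

(** Coherence and noise shift the top coefficient by at most [beta (|x_k| - |x_j|) <= 1/2], and
    [|x_k| <= 1]. This bound is free of [A], unlike the one through the norm of the signal. *)
Lemma dotv_top_atom_le (rho beta : R) x r k : (1 < K)%N -> in_dict Phi ->
  gapped (coherence Phi) rho beta x k -> norm2 x = 1 -> norm2 r <= rho ->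
  beta < 1 / 2 -> `|dotv (Phi k) (signal x r)| <= 3 / 2.
Proof.
move=> K1 P1 g x1 rr b.
have [j jk] : exists j : 'I_K, j != k.
  have [k0|k0] := eqVneq k (Ordinal (ltnW K1)).
    by exists (Ordinal K1); rewrite k0.
  by exists (Ordinal (ltnW K1)); rewrite eq_sym.
have [l H] := g j jk.
have := dotv_atom_signal x r k P1.
have xk : `|x k| <= 1 by rewrite -x1 abs_coord_le.
have := ler_normD (dotv (Phi k) (signal x r) - x k) (x k); rewrite subrK.
have : beta * (`|x k| - `|x j|) <= 1 / 2 * (`|x k| - `|x j|).
  by rewrite ler_wpM2r; lra.
have := normr_ge0 (x j); lra.
Qed.

(** Each inner product moves by at most [e (sqrt A + rho)]. For [Phi] itself the margin between [k]
    and [j] is at least [(1 - 2 beta)(|x_k| - |x_j|)], and [|x_k| - |x_j| >= 2/3 |x_k| >= 2 / (3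
    sqrt K)]; comparing with twice the perturbation gives the factor 3. *)
Lemma argmax_stable (A rho beta e : R) x r k Psi :
  0 <= A -> unit_norm_tight_frame Phi A ->
  gapped (coherence Phi) rho beta x k -> norm2 x = 1 -> norm2 r <= rho ->
  beta < 1 / 2 -> 0 <= e ->
  3 * e * (Num.sqrt A + rho) * Num.sqrt K%:R <= 1 - 2 * beta ->
  dict_dist Psi Phi <= e ->
  forall j, `|dotv (Psi j) (signal x r)| <= `|dotv (Psi k) (signal x r)|.
Proof.
move=> A0 tf g x1 rr b e0 He PP j.
have [->//|jk] := eqVneq j k.
have P1 : in_dict Phi by case: tf.
have [l H] := g j jk.
have rho0 : 0 <= rho by exact: le_trans (norm2_ge0 r) rr.
have C0 : 0 <= Num.sqrt A + rho by rewrite addr_ge0 ?sqrtr_ge0.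
have pert i : `|dotv (Psi i) (signal x r) - dotv (Phi i) (signal x r)|
    <= e * (Num.sqrt A + rho).
  rewrite -dotvBl; apply: le_trans (abs_dotv_le _ _) _.
  apply: ler_pM; rewrite ?norm2_ge0// ?norm2_signal//.
  by have /(dict_dist_le _ _ e0) := PP; apply.
have := pert j; have := pert k.
have := dotv_atom_signal x r k P1; have := dotv_atom_signal x r j P1.
set S := coherence Phi * _ in H *; move=> h1 h2 h3 h4.
have K0 : (0 : R) < K%:R by rewrite ltr0n (leq_trans _ (ltn_ord k)).
have big : 1 <= Num.sqrt K%:R * `|x k|.
  rewrite -(@ler_pXn2r _ 2) ?nnegrE ?mulr_ge0 ?sqrtr_ge0// expr1n exprMn.
  by rewrite sqr_sqrtr ?(ltW K0)// (gapped_large g).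
have rat := gapped_ratio g coherence_ge0 rho0 b jk.
have sK : 0 < Num.sqrt K%:R :> R by rewrite sqrtr_gt0.
have key : 3 * e * (Num.sqrt A + rho) <= (1 - 2 * beta) * `|x k|.
  rewrite -(ler_pM2r sK); apply: le_trans He _.
  rewrite -mulrA -[leLHS]mulr1 ler_wpM2l// ?[_ * Num.sqrt _]mulrC//; lra.
have key2 : (1 - 2 * beta) * (2 / 3 * `|x k|) <=
            (1 - 2 * beta) * (`|x k| - `|x j|).
  by rewrite ler_wpM2l; lra.
have n1 := ler_normD (dotv (Psi j) (signal x r) - dotv (Phi j) (signal x r))
   (dotv (Phi j) (signal x r)).
have n2 := ler_normD (dotv (Phi j) (signal x r) - x j) (x j).
have n3 := ler_normD (dotv (Phi k) (signal x r) - dotv (Psi k) (signal x r))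
   (dotv (Psi k) (signal x r)).
have n4 := ler_normD (x k - dotv (Phi k) (signal x r)) (dotv (Phi k) (signal x r)).
rewrite !subrK in n1 n2 n3 n4; rewrite distrC in n3; rewrite distrC in n4.
have := normr_ge0 (x j).
lra.
Qed.

Lemma frame_constant_ge1 (A : R) : (0 < K)%N -> unit_norm_tight_frame Phi A ->
  1 <= A.
Proof.
move=> K0 [P1 tf]; pose k := Ordinal K0.
have := tf (Phi k); rewrite P1 expr1n mulr1 => <-.
rewrite (bigD1 k) //= -sqr_norm2 P1 !expr1n lerDl.
by apply: sumr_ge0 => i _; rewrite sqr_ge0.
Qed.

Lemma frame_polar (A : R) u v : unit_norm_tight_frame Phi A ->
  \sum_k dotv u (Phi k) * dotv v (Phi k) = A * dotv u v.
Proof.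
move=> [_ tf].
have := tf (fun i => u i + v i); have := tf u; have := tf v.
rewrite !sqr_norm2 !dotvDl !dotvDr (dotvC v u).
have -> : \sum_k dotv (Phi k) (fun i => u i + v i) ^+ 2 =
  \sum_k dotv (Phi k) u ^+ 2 + \sum_k dotv (Phi k) v ^+ 2 +
  2 * \sum_k dotv u (Phi k) * dotv v (Phi k).
  rewrite mulr_sumr -!big_split /=; apply: eq_bigr => k _.
  by rewrite dotvDr !(dotvC _ (Phi k)); ring.
by lra.
Qed.

End Signals.

(** * Bounded measurable functions and independence *)

Section BoundedMeasurable.
Context {R : realType} {dT : measure_display} {T : measurableType dT}.
Implicit Types f g : T -> R.

(** Bounded everywhere, not just almost everywhere: the class is closed under sums, products and
    [expR], and its members are integrable for every probability measure. *)
Definition bmeas f :=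
  measurable_fun [set: T] f /\ exists M, forall x, `|f x| <= M.

Lemma bmeas_cst c : bmeas (fun=> c).
Proof. by split; [exact: measurable_cst|exists `|c|]. Qed.

Lemma bmeasD f g : bmeas f -> bmeas g -> bmeas (fun x => f x + g x).
Proof.
move=> [mf [M fM]] [mg [M' gM]]; split; first exact: measurable_funD.
by exists (M + M') => x; apply: le_trans (ler_normD _ _) _; rewrite lerD.
Qed.

Lemma bmeasM f g : bmeas f -> bmeas g -> bmeas (fun x => f x * g x).
Proof.
move=> [mf [M fM]] [mg [M' gM]]; split; first exact: measurable_funM.
by exists (M * M') => x; rewrite normrM ler_pM.
Qed.

Lemma bmeasN f : bmeas f -> bmeas (fun x => - f x).
Proof.
move=> bf; rewrite (_ : (fun _ => _) = (fun x => -1 * f x)).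
  by apply: bmeasM => //; exact: bmeas_cst.
by apply/funext => x; rewrite mulN1r.
Qed.

Lemma bmeasB f g : bmeas f -> bmeas g -> bmeas (fun x => f x - g x).
Proof. by move=> bf bg; apply: bmeasD => //; exact: bmeasN. Qed.

Lemma bmeas_sum (I : finType) (F : I -> T -> R) :
  (forall i, bmeas (F i)) -> bmeas (fun x => \sum_i F i x).
Proof.
move=> bF; elim: (index_enum I) => [|i s IH].
  under eq_fun do rewrite big_nil; exact: bmeas_cst.
under eq_fun do rewrite big_cons; exact: bmeasD.
Qed.

Lemma bmeas_prod (I : finType) (F : I -> T -> R) :
  (forall i, bmeas (F i)) -> bmeas (fun x => \prod_i F i x).
Proof.
move=> bF; elim: (index_enum I) => [|i s IH].
  under eq_fun do rewrite big_nil; exact: bmeas_cst.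
under eq_fun do rewrite big_cons; exact: bmeasM.
Qed.

Lemma bmeas_indic (A : set T) : measurable A -> bmeas (\1_A : T -> R).
Proof.
move=> mA; split; first exact: measurable_indic.
by exists 1 => x; rewrite indicE; case: (x \in A); rewrite ?normr1 ?normr0.
Qed.

Lemma bmeas_expR f : bmeas f -> bmeas (fun x => expR (f x)).
Proof.
move=> [mf [M fM]]; split; first exact: measurableT_comp.
exists (expR M) => x; rewrite ger0_norm ?expR_ge0// ler_expR.
exact: le_trans (ler_norm _) (fM x).
Qed.

Variable P : probability T R.

Lemma bmeas_integrable f : bmeas f -> P.-integrable [set: T] (EFin \o f).
Proof.
move=> [mf [M fM]]; apply: measurable_bounded_integrable => //.
  exact: le_lt_trans (probability_le1 P measurableT) (ltry 1).
exists M; split; first exact: num_real.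
by move=> y My x _ /=; exact: le_trans (fM x) (ltW My).
Qed.

Lemma EFin_Rintegral f : bmeas f ->
  (\int[P]_x f x)%:E = (\int[P]_x (f x)%:E)%E.
Proof.
by move=> /bmeas_integrable bf; rewrite fineK// integrable_fin_num.
Qed.

Lemma Rint_cst (c : R) : \int[P]_(x in setT) c = c.
Proof.
rewrite Rintegral_cst//.
rewrite [X in fine X](_ : _ = 1%E); last exact: probability_setT.
by rewrite mulr1.
Qed.

Lemma RintD f g : bmeas f -> bmeas g ->
  \int[P]_x (f x + g x) = \int[P]_x f x + \int[P]_x g x.
Proof. by move=> bf bg; rewrite RintegralD//; exact: bmeas_integrable. Qed.

Lemma RintZ c f : bmeas f -> \int[P]_x (c * f x) = c * \int[P]_x f x.
Proof. by move=> bf; rewrite RintegralZl//; exact: bmeas_integrable. Qed.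

Lemma RintN f : bmeas f -> \int[P]_x (- f x) = - \int[P]_x f x.
Proof.
by move=> bf; under eq_Rintegral do rewrite -mulN1r; rewrite RintZ// mulN1r.
Qed.

Lemma RintB f g : bmeas f -> bmeas g ->
  \int[P]_x (f x - g x) = \int[P]_x f x - \int[P]_x g x.
Proof. by move=> bf bg; rewrite RintD ?RintN//; exact: bmeasN. Qed.

Lemma Rint_sum (I : finType) (F : I -> T -> R) : (forall i, bmeas (F i)) ->
  \int[P]_x (\sum_i F i x) = \sum_i \int[P]_x F i x.
Proof.
move=> bF.
suff [] : bmeas (fun x => \sum_(i <- index_enum I) F i x) /\
  \int[P]_x (\sum_(i <- index_enum I) F i x) =
  \sum_(i <- index_enum I) \int[P]_x F i x by [].
elim: (index_enum I) => [|i s [bs IH]].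
  split; first by under eq_fun do rewrite big_nil; exact: bmeas_cst.
  by under eq_Rintegral do rewrite big_nil; rewrite Rint_cst big_nil.
split; first by under eq_fun do rewrite big_cons; exact: bmeasD.
by under eq_Rintegral do rewrite big_cons; rewrite RintD// big_cons IH.
Qed.

Lemma Rint_le f g : bmeas f -> bmeas g -> (forall x, f x <= g x) ->
  \int[P]_x f x <= \int[P]_x g x.
Proof. by move=> bf bg fg; apply: le_Rintegral => //; exact: bmeas_integrable. Qed.

Lemma Rint_ae f g (A : set T) : measurable A -> P A = 1%E ->
  measurable_fun [set: T] f -> measurable_fun [set: T] g ->
  (forall x, A x -> f x = g x) -> \int[P]_x f x = \int[P]_x g x.
Proof.
move=> mA PA mf mg fg; congr fine; apply: ae_eq_integral => //.
- exact/measurable_EFinP.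
- exact/measurable_EFinP.
exists (~` A); split; first exact: measurableC.
  have : P (~` A) = 0%E by rewrite probability_setC// PA subee.
  by [].
move=> x /= nfg Ax; apply: nfg => _; by rewrite fg.
Qed.

End BoundedMeasurable.

Lemma bmeas_comp (R : realType) (dT dS : measure_display)
    (T : measurableType dT) (S : measurableType dS) (phi : S -> T) (f : T -> R) :
  measurable_fun [set: S] phi -> bmeas f -> bmeas (fun w => f (phi w)).
Proof.
move=> mphi [mf [M fM]]; split; first exact: measurableT_comp.
by exists M.
Qed.

Section Transfer.
Context {R : realType} {dO dT : measure_display} {Omega : measurableType dO}
  {T : measurableType dT} (P : probability Omega R).

Import HBNNSimple.

(** The identity passes from indicators to simple functions by linearity and to nonnegative
    measurable functions by monotone convergence. Both product formulas for independent variables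
    reduce to it, with [h] formed from the other factors. *)
Lemma density_transfer (h : Omega -> R) (Z : Omega -> T) (c : R) :
  (forall w, 0 <= h w) -> measurable_fun setT h -> measurable_fun setT Z ->
  0 <= c ->
  (forall A, measurable A ->
    \int[P]_w (h w * \1_A (Z w))%:E = c%:E * P (Z @^-1` A))%E ->
  forall f : T -> R, measurable_fun setT f -> (forall t, 0 <= f t) ->
  (\int[P]_w (h w * f (Z w))%:E = c%:E * \int[P]_w (f (Z w))%:E)%E.
Proof.
move=> h0 mh mZ c0 HA f mf f0.
have mEf : measurable_fun setT (EFin \o f) by exact/measurable_EFinP.
pose f_ := nnsfun_approx measurableT mEf.
have mfn n : measurable_fun setT (fun w => f_ n (Z w)).
  by apply: measurableT_comp => //; exact: measurable_funP.
have cvf t : (fun n => f_ n t) @ \oo --> f t.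
  have := @cvg_nnsfun_approx _ _ _ _ measurableT _ mEf.
  by move=> /(_ (fun t _ => f0 t) t I) /fine_cvg.
have step (g : Omega -> R) : (forall w, 0 <= g w) -> measurable_fun setT g ->
    (\int[P]_w (g w * f (Z w))%:E =
     limn (fun n => \int[P]_w (g w * f_ n (Z w))%:E))%E.
  move=> g0 mg; rewrite -monotone_convergence//.
  - apply: eq_integral => w _; apply/esym/cvg_lim => //.
    apply/cvg_EFin; first by near=> n.
    by apply: cvgM; [exact: cvg_cst|exact: cvf].
  - by move=> n; apply/measurable_EFinP/measurable_funM.
  - by move=> n w _; rewrite lee_fin mulr_ge0.
  - move=> w _ m n mn; rewrite lee_fin ler_wpM2l//.
    exact/lefP/nd_nnsfun_approx.
rewrite step// -ge0_integralZl_EFin//; last 2 first.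
- by move=> w _; rewrite lee_fin.
- by apply/measurable_EFinP; exact: measurableT_comp.
under [RHS]eq_integral do rewrite -EFinM.
rewrite (step (fun=> c))//; congr (limn _); apply/funext => n.
have mpre r : measurable (Z @^-1` (f_ n @^-1` [set r])).
  by rewrite -[X in measurable X]setTI; apply: mZ.
have expand (g : Omega -> R) : (forall w, 0 <= g w) -> measurable_fun setT g ->
    (\int[P]_w (g w * f_ n (Z w))%:E = \sum_(k \in range (f_ n))
      (k%:E * \int[P]_w (g w * \1_(f_ n @^-1` [set k]) (Z w))%:E))%E.
  move=> g0 mg.
  have mi k : measurable_fun setT
      (fun w => g w * \1_(f_ n @^-1` [set k]) (Z w)).
    by apply: measurable_funM => //; apply: measurableT_comp.
  have i0 k w : 0 <= g w * \1_(f_ n @^-1` [set k]) (Z w) by rewrite mulr_ge0.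
  have ki0 k w : (0 <= (k * (g w * \1_(f_ n @^-1` [set k]) (Z w)))%:E)%E.
    rewrite lee_fin mulrCA mulr_ge0// indicE.
    case: (boolP (_ \in _)) => [|_]; rewrite ?mulr0// mulr1.
    by move=> /set_mem /= <-.
  transitivity (\int[P]_w \sum_(k \in range (f_ n))
      (k * (g w * \1_(f_ n @^-1` [set k]) (Z w)))%:E)%E.
    apply: eq_integral => w _; rewrite {1}fimfunE fsumEFin//.
    by rewrite mulr_fsumr//; congr EFin; apply: eq_fsbigr => k _; rewrite mulrCA.
  rewrite ge0_integral_fsum//; last first.
    by move=> k; apply/measurable_EFinP/measurable_funM.
  apply: eq_fsbigr => k /set_mem [t _ <-].
  rewrite -ge0_integralZl_EFin//.
  - by move=> w _; rewrite lee_fin.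
  - exact/measurable_EFinP.
rewrite !expand//; apply: eq_fsbigr => k _; rewrite HA//; congr (_ * _)%E.
under eq_integral do rewrite EFinM.
rewrite ge0_integralZl_EFin//; last first.
  by apply/measurable_EFinP; apply: measurableT_comp.
congr (_ * _)%E.
rewrite (_ : (fun _ => _) = (fun w => (\1_(Z @^-1` (f_ n @^-1` [set k])) w)%:E)).
  by rewrite integral_indic// setIT.
by apply/funext => w; rewrite !indicE.
Unshelve. all: by end_near. Qed.

End Transfer.

Section Independence.
Context {R : realType} {dO : measure_display} {Omega : measurableType dO}
  (P : probability Omega R).

Lemma Rint_indic (dT : measure_display) (T : measurableType dT)
    (Z : Omega -> T) (A : set T) : measurable_fun setT Z -> measurable A ->
  (\int[P]_w (\1_A (Z w) : R))%:E = P (Z @^-1` A).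
Proof.
move=> mZ mA.
have mZA : measurable (Z @^-1` A) by rewrite -[X in measurable X]setTI; apply: mZ.
have -> : (fun w => \1_A (Z w) : R) = \1_(Z @^-1` A).
  by apply/funext => w; rewrite !indicE.
rewrite EFin_Rintegral; last exact: bmeas_indic.
by rewrite integral_indic// setIT.
Qed.

Lemma density_Rint (dT : measure_display) (T : measurableType dT)
    (h : Omega -> R) (Z : Omega -> T) (c : R) :
  (forall w, 0 <= h w) -> bmeas h -> measurable_fun setT Z -> 0 <= c ->
  (forall A, measurable A ->
    \int[P]_w (h w * \1_A (Z w)) = c * \int[P]_w (\1_A (Z w))) ->
  forall f : T -> R, bmeas f -> (forall t, 0 <= f t) ->
  \int[P]_w (h w * f (Z w)) = c * \int[P]_w f (Z w).
Proof.
move=> h0 bh mZ c0 HA f bf f0; apply: EFin_inj.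
have [mh _] := bh; have [mf _] := bf.
have bfZ := bmeas_comp mZ bf.
rewrite EFinM EFin_Rintegral; last exact: bmeasM.
rewrite EFin_Rintegral//; apply: density_transfer => // A mA.
rewrite -EFin_Rintegral; last first.
  by apply: bmeasM => //; apply: (bmeas_comp mZ); exact: bmeas_indic.
by rewrite HA// EFinM Rint_indic.
Qed.

Lemma indep2_Rint (d1 d2 : measure_display) (T1 : measurableType d1)
    (T2 : measurableType d2) (X : Omega -> T1) (Y : Omega -> T2)
    (F : T1 -> R) (H : T2 -> R) :
  measurable_fun setT X -> measurable_fun setT Y -> indep2 P X Y ->
  bmeas F -> bmeas H ->
  \int[P]_w (F (X w) * H (Y w)) = \int[P]_w F (X w) * \int[P]_w H (Y w).
Proof.
move=> mX mY ind bF bH.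
have pos (F' : T1 -> R) (H' : T2 -> R) : bmeas F' -> bmeas H' ->
    (forall t, 0 <= F' t) -> (forall t, 0 <= H' t) ->
    \int[P]_w (F' (X w) * H' (Y w)) = \int[P]_w F' (X w) * \int[P]_w H' (Y w).
  move=> bF' bH' F0 H0.
  have bHY := bmeas_comp mY bH'.
  have step A : measurable A -> \int[P]_w (\1_A (X w) * H' (Y w)) =
      \int[P]_w (\1_A (X w)) * \int[P]_w H' (Y w).
    move=> mA; have b1 := bmeas_comp mX (@bmeas_indic R _ _ _ mA).
    apply: density_Rint => //.
      by apply: Rintegral_ge0.
    move=> B mB; apply: EFin_inj; rewrite EFinM !Rint_indic// -ind//.
    have -> : (fun w => \1_A (X w) * \1_B (Y w) : R) =
       (fun w => \1_(X @^-1` A `&` Y @^-1` B) w).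
      by apply/funext => w; rewrite indicI.
    rewrite (@Rint_indic _ _ id)//.
    apply: measurableI; rewrite -[X in measurable X]setTI; [exact: mX|exact: mY].
  under eq_Rintegral do rewrite mulrC.
  rewrite mulrC; apply: density_Rint => //.
    by apply: Rintegral_ge0.
  move=> A mA; under eq_Rintegral do rewrite mulrC.
  by rewrite step// mulrC.
have [_ [M FM]] := bF; have [_ [L HL]] := bH.
have bFX := bmeas_comp mX bF; have bHY := bmeas_comp mY bH.
(* Adding the bounds [M] and [L] makes both functions nonnegative; after expansion the extra terms
   cancel by linearity. *)
have := pos (fun t => F t + M) (fun t => H t + L) _ _ _ _.
have F0 t : 0 <= F t + M by have := FM t; rewrite ler_norml => /andP[]; lra.
have H0 t : 0 <= H t + L by have := HL t; rewrite ler_norml => /andP[]; lra.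
have bc c : bmeas (fun w : Omega => c : R) by exact: bmeas_cst.
move=> /(_ (bmeasD bF (bmeas_cst M)) (bmeasD bH (bmeas_cst L)) F0 H0).
have -> : (fun w => (F (X w) + M) * (H (Y w) + L)) =
  (fun w => F (X w) * H (Y w) + (L * F (X w) + (M * H (Y w) + M * L))).
  by apply/funext => w; ring.
have bFH := bmeasM bFX bHY.
have b1 := bmeasM (bc L) bFX; have b2 := bmeasM (bc M) bHY.
have b3 := bmeasD b2 (bc (M * L)).
have -> : \int[P]_w (F (X w) + M) = \int[P]_w F (X w) + M.
  by rewrite RintD// Rint_cst.
have -> : \int[P]_w (H (Y w) + L) = \int[P]_w H (Y w) + L.
  by rewrite RintD// Rint_cst.
rewrite RintD//; last exact: bmeasD.
rewrite RintD// RintD// !RintZ// Rint_cst => E.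
by apply/eqP; rewrite -subr_eq0; apply/eqP; move: E; lra.
Qed.

(** Induction on a list [s] of indices outside of which the factors are indicators. The empty list
    is the definition of independence; each step frees one factor, the product of the remaining ones
    serving as the density. *)
Lemma mutually_indep_Rint (N : nat) (dT : measure_display)
    (T : measurableType dT) (Z : 'I_N -> Omega -> T) (f : 'I_N -> T -> R) :
  (forall n, measurable_fun setT (Z n)) -> mutually_indep P Z ->
  (forall n, bmeas (f n)) -> (forall n t, 0 <= f n t) ->
  \int[P]_w (\prod_n f n (Z n w)) = \prod_n \int[P]_w f n (Z n w).
Proof.
move=> mZ ind.
suff H (s : seq 'I_N) : forall f : 'I_N -> T -> R,
    (forall n, bmeas (f n)) -> (forall n t, 0 <= f n t) ->
    (forall n, n \notin s -> exists2 A, measurable A & f n = \1_A) ->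
    \int[P]_w (\prod_n f n (Z n w)) = \prod_n \int[P]_w f n (Z n w).
  move=> bf f0; apply: (H (enum 'I_N)) => // n; by rewrite mem_enum.
elim: s => [|i s IH] {}f bf f0 fs.
  have /choice[A AP] n : exists A, measurable A /\ f n = \1_A.
    by have [A mA fA] := fs n isT; exists A.
  have mA n : measurable (A n) by have [] := AP n.
  have fA n : f n = \1_(A n) by have [] := AP n.
  have -> : (fun w => \prod_n f n (Z n w)) =
      (fun w => \1_(\bigcap_(n in [set: 'I_N]) (Z n @^-1` A n)) w).
    apply/funext => w; rewrite indicE; case: (boolP (w \in _)) => [/set_mem|] h.
      by rewrite big1// => n _; rewrite fA indicE mem_set//; exact: h.
    have [n nA] : exists n, ~ A n (Z n w).
      apply/existsNP => hA; move/negP: h; apply; apply/mem_set => n _; exact: hA.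
    by rewrite (bigD1 n)//= fA indicE memNset// mul0r.
  apply: EFin_inj; rewrite (@Rint_indic _ _ id)//; last first.
    apply: fin_bigcap_measurable => // n _.
    by rewrite -[X in measurable X]setTI; apply: mZ.
  apply: etrans (ind _ mA) _; rewrite -prodEFin; apply: eq_bigr => n _.
  by rewrite fA Rint_indic.
pose h w := \prod_(n | n != i) f n (Z n w).
have bh : bmeas h.
  rewrite /h; under eq_fun do rewrite big_mkcond /=.
  apply: bmeas_prod => n; case: (n != i); last exact: bmeas_cst.
  exact: bmeas_comp.
have bigE g : \prod_n g n = (\prod_(n | n != i) g n) * g i :> R.
  by rewrite (bigD1 i)//= mulrC.
rewrite bigE; under eq_Rintegral do rewrite bigE.
apply: density_Rint => //.
- by move=> w; apply: prodr_ge0 => n _.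
- by apply: prodr_ge0 => n _; apply: Rintegral_ge0.
move=> A mA; pose f' n := if n == i then \1_A else f n.
have fi : f' i = \1_A by rewrite /f' eqxx.
have -> : (fun w => h w * \1_A (Z i w)) = (fun w => \prod_n f' n (Z n w)).
  apply/funext => w; rewrite bigE fi; congr (_ * _).
  by apply: eq_bigr => n /negbTE ni; rewrite /f' ni.
rewrite IH ?bigE ?fi.
- by congr (_ * _); apply: eq_bigr => n /negbTE ni; rewrite /f' ni.
- by move=> n; rewrite /f'; case: ifP => _ //; exact: bmeas_indic.
- by move=> n t; rewrite /f'; case: ifP.
- move=> n ns; rewrite /f'; case: eqVneq => [_|ni]; first by exists A.
  by apply: fs; rewrite inE negb_or ni.
Qed.

End Independence.

(** * A Bernstein inequality with second moments *)

Section Bernstein.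
Context {R : realType}.

(* From e^(x/2) <= 1 / (1 - x/2). *)
Lemma expR_le_quadratic (x : R) : x <= 1 / 3 -> expR x <= 1 + x + x ^+ 2.
Proof.
move=> x3; have y0 : 0 < 1 - x / 2 by lra.
have e1 : expR (x / 2) * (1 - x / 2) <= 1.
  have := expR_ge1Dx (- (x / 2)); rewrite expRN => h.
  rewrite -[leRHS](@mulfV _ (expR (x / 2))) ?gt_eqF ?expR_gt0//.
  by rewrite ler_wpM2l ?expR_ge0.
have e2 : expR x * (1 - x / 2) ^+ 2 <= 1.
  have -> : expR x = expR (x / 2) ^+ 2.
    by rewrite expr2 -expRD; congr expR; lra.
  by rewrite -exprMn expr_le1// mulr_ge0 ?expR_ge0 ?ltW.
rewrite -(@ler_pM2r _ ((1 - x / 2) ^+ 2)) ?exprn_gt0//.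
apply: le_trans e2 _.
have -> : (1 + x + x ^+ 2) * (1 - x / 2) ^+ 2 =
  1 + x ^+ 2 * ((1 - 3 * x + x ^+ 2) / 4) by field.
rewrite lerDl mulr_ge0 ?sqr_ge0// divr_ge0//.
by rewrite addr_ge0 ?sqr_ge0//; lra.
Qed.

Context {dO dT : measure_display} {Omega : measurableType dO}
  {T : measurableType dT} (P : probability Omega R) {N : nat}
  (Z : 'I_N -> Omega -> T).

Lemma bernstein_upper (f : T -> R) (m v b t : R) :
  (0 < N)%N -> (forall n, measurable_fun setT (Z n)) -> mutually_indep P Z ->
  measurable_fun setT f -> (forall z, `|f z| <= b) ->
  (forall n, \int[P]_w f (Z n w) = m) ->
  (forall n, \int[P]_w (f (Z n w) ^+ 2) <= v) ->
  0 < t -> 0 < v -> 3 * t * b <= v ->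
  (P [set w | (t <= N%:R^-1 * \sum_n f (Z n w) - m)%R] <=
    (expR (- (N%:R * t ^+ 2 / (4 * v))))%:E)%E.
Proof.
move=> N0 mZ ind mf fb fm fv t0 v0 tbv.
have NR : (0 : R) < N%:R by rewrite ltr0n.
have bf : bmeas f by split => //; exists b.
have bfZ n := bmeas_comp (mZ n) bf.
have bc c : bmeas (fun w : Omega => c : R) by exact: bmeas_cst.
pose n0 := Ordinal N0.
have mb : `|m| <= b.
  rewrite -(fm n0) ler_norml; apply/andP; split.
    rewrite -(Rint_cst P (- b)); apply: Rint_le => // w.
    by have := fb (Z n0 w); rewrite ler_norml => /andP[].
  rewrite -(Rint_cst P b); apply: Rint_le => // w.
  by have := fb (Z n0 w); rewrite ler_norml => /andP[].
(* This [s] minimizes [s^2 v - s t], with value [- t^2 / (4 v)]. The hypothesis [3 t b <= v] gives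
   [2 s b <= 1/3], the range of the quadratic bound on [expR]. *)
pose s := t / (2 * v).
have s0 : 0 < s by rewrite divr_gt0 ?mulr_gt0.
pose g z := expR (s * (f z - m)).
have bg : bmeas g.
  by apply: bmeas_expR; apply: bmeasM; [|apply: bmeasB => //]; exact: bmeas_cst.
have bgZ n := bmeas_comp (mZ n) bg.
have mgf n : \int[P]_w g (Z n w) <= expR (s ^+ 2 * v).
  apply: (@le_trans _ _ (1 + s ^+ 2 * v)); last exact: expR_ge1Dx.
  have bd := bmeasB (bfZ n) (bc m).
  have bs := bmeasM (bc s) bd.
  have bs2 := bmeasM bs bs.
  apply: (@le_trans _ _ (\int[P]_w (1 + s * (f (Z n w) - m) +
      (s * (f (Z n w) - m)) * (s * (f (Z n w) - m))))).
    apply: Rint_le => //; first by apply: bmeasD => //; exact: bmeasD.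
    move=> w; rewrite /g -expr2; apply: expR_le_quadratic.
    have : f (Z n w) - m <= 2 * b.
      have := fb (Z n w); move: mb; rewrite !ler_norml => /andP[? ?] /andP[? ?].
      lra.
    move=> /(ler_wpM2l (ltW s0)) /le_trans; apply.
    by rewrite /s mulrAC ler_pdivrMr ?mulr_gt0//; lra.
  rewrite RintD//; last exact: bmeasD.
  rewrite RintD// Rint_cst RintZ// RintB// Rint_cst fm subrr mulr0 addr0 lerD2l.
  (* The centred second moment is [E f^2 - m^2], hence at most [v]. *)
  have -> : (fun w => s * (f (Z n w) - m) * (s * (f (Z n w) - m))) =
     (fun w => s ^+ 2 * (f (Z n w) ^+ 2 + (- (2 * m) * f (Z n w) + m ^+ 2))).
    by apply/funext => w; ring.
  have b1 := bmeasM (bc (- (2 * m))) (bfZ n).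
  have b2 := bmeasM (bfZ n) (bfZ n).
  have b3 := bmeasD b1 (bc (m ^+ 2)).
  rewrite RintZ; last exact: (bmeasD b2 b3).
  rewrite RintD// RintD// RintZ// Rint_cst fm ler_wpM2l ?sqr_ge0//.
  by have := fv n; have := sqr_ge0 m; rewrite !expr2; lra.
pose E := [set w | t <= N%:R^-1 * \sum_n f (Z n w) - m].
have mE : measurable E.
  rewrite -[E]setTI; apply: measurable_fun_le => //.
  have [] // := bmeasB (bmeasM (bc N%:R^-1) (bmeas_sum bfZ)) (bc m).
have bW : bmeas (fun w => \prod_n g (Z n w)) by exact: bmeas_prod.
have bE : bmeas (\1_E : Omega -> R) by exact: bmeas_indic.
have PE : P E = (\int[P]_w (\1_E w : R))%:E by rewrite (@Rint_indic _ _ _ P _ _ id).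
rewrite -[X in (X <= _)%E]/(P E) PE lee_fin.
(* Markov's inequality: on [E] the product of exponentials is at least [expR (s N t)], and elsewhere
   it is nonnegative. *)
have key : expR (s * (N%:R * t)) * \int[P]_w \1_E w <= \int[P]_w (\prod_n g (Z n w)).
  rewrite -RintZ//; apply: Rint_le => //; first exact: bmeasM.
  move=> w; rewrite indicE; case: (boolP (w \in E)) => [/set_mem Ew|_]; last first.
    by rewrite mulr0; apply: prodr_ge0 => n _; exact: expR_ge0.
  rewrite mulr1 /g -expR_sum ler_expR -mulr_sumr ler_wpM2l ?(ltW s0)//.
  rewrite sumrB sumr_const card_ord -[X in _ - X]mulr_natl.
  have := ler_wpM2l (ltW NR) Ew; rewrite mulrBr mulrA divff ?gt_eqF// mul1r.
  by [].
have WE : \int[P]_w (\prod_n g (Z n w)) <= expR (N%:R * (s ^+ 2 * v)).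
  rewrite (mutually_indep_Rint (f := fun=> g))//; last by move=> *; exact: expR_ge0.
  rewrite mulr_natl -[in leRHS](card_ord N) -sumr_const expR_sum.
  apply: ler_prod => n _; rewrite mgf andbT.
  by apply: Rintegral_ge0 => w _; exact: expR_ge0.
have := le_trans key WE; rewrite mulrC -ler_pdivlMr ?expR_gt0// -expRN -expRD.
move=> /le_trans; apply; rewrite ler_expR le_eqVlt; apply/orP; left; apply/eqP.
by rewrite /s; field; rewrite gt_eqF.
Qed.

Lemma bernstein (f : T -> R) (m v b t : R) :
  (0 < N)%N -> (forall n, measurable_fun setT (Z n)) -> mutually_indep P Z ->
  measurable_fun setT f -> (forall z, `|f z| <= b) ->
  (forall n, \int[P]_w f (Z n w) = m) ->
  (forall n, \int[P]_w (f (Z n w) ^+ 2) <= v) ->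
  0 < t -> 0 < v -> 3 * t * b <= v ->
  let E := [set w | t <= `|N%:R^-1 * \sum_n f (Z n w) - m|] in
  measurable E /\
  (P E <= (2 * expR (- (N%:R * t ^+ 2 / (4 * v))))%:E)%E.
Proof.
move=> N0 mZ ind mf fb fm fv t0 v0 tbv E.
have bf : bmeas f by split => //; exists b.
have bfZ n := bmeas_comp (mZ n) bf.
have bc c : bmeas (fun w : Omega => c : R) by exact: bmeas_cst.
pose a w := N%:R^-1 * \sum_n f (Z n w) - m.
have [ma _] : bmeas a by exact: bmeasB (bmeasM (bc N%:R^-1) (bmeas_sum bfZ)) (bc m).
pose E1 := [set w | t <= a w]; pose E2 := [set w | t <= - a w].
have mE1 : measurable E1.
  by rewrite -[E1]setTI; apply: measurable_fun_le.
have mE2 : measurable E2.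
  rewrite -[E2]setTI; apply: measurable_fun_le => //.
  exact: (measurable_funN ma).
have EE : E = E1 `|` E2.
  by apply/seteqP; split => w; rewrite /E /E1 /E2 /= ler_normr => /orP.
rewrite EE; split; first exact: measurableU.
apply: le_trans (measureU2 _ _ _) _ => //.
have -> : 2 * expR (- (N%:R * t ^+ 2 / (4 * v))) =
  expR (- (N%:R * t ^+ 2 / (4 * v))) + expR (- (N%:R * t ^+ 2 / (4 * v))).
  by rewrite mulr_natl mulr2n.
rewrite EFinD; apply: leeD; first exact: (@bernstein_upper f m v b t).
have -> : E2 = [set w | t <= N%:R^-1 * \sum_n (- f (Z n w)) - (- m)].
  apply/seteqP; split => w; rewrite /E2 /a /= sumrN mulrN;
    by rewrite -opprD.
apply: (@bernstein_upper (fun z => - f z) (- m) v b t) => //.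
- exact: (measurable_funN mf).
- by move=> z; rewrite normrN.
- by move=> n; rewrite RintN// fm.
- by move=> n; under eq_Rintegral do rewrite sqrrN.
Qed.

End Bernstein.

(** * Moments of symmetric coefficient distributions *)

Section MeasurableTuples.
Context {R : realType} {n : nat}.

Lemma measurable_coord (i : 'I_n) :
  measurable_fun setT (fun x : n.-tuple R => tnth x i).
Proof. exact: measurable_tnth. Qed.

Lemma measurable_abs_coord (i : 'I_n) :
  measurable_fun setT (fun x : n.-tuple R => `|tvec x i|).
Proof. by apply: measurableT_comp => //; exact: measurable_coord. Qed.

Lemma measurable_norm2 : measurable_fun setT (fun x : n.-tuple R => norm2 (tvec x)).
Proof.
apply: (@measurableT_comp _ _ _ _ _ _ (Num.sqrt : R -> R) _
  (fun x : n.-tuple R => \sum_i tvec x i ^+ 2)).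
  apply: continuous_measurable_fun; exact: sqrt_continuous.
apply: measurable_sum => i; apply: measurable_funX; exact: measurable_coord.
Qed.

Lemma measurable_norm1 :
  measurable_fun setT (fun x : n.-tuple R => \sum_i `|tvec x i|).
Proof. by apply: measurable_sum => i; exact: measurable_abs_coord. Qed.

End MeasurableTuples.

Section ProbabilityOne.
Context {R : realType} {dT : measure_display} {T : measurableType dT}
  (P : probability T R).

Lemma prob1_setI (A B : set T) : measurable A -> measurable B ->
  P A = 1%E -> P B = 1%E -> P (A `&` B) = 1%E.
Proof.
move=> mA mB PA PB.
have cA : P (~` A) = 0%E by rewrite probability_setC// PA subee.
have cB : P (~` B) = 0%E by rewrite probability_setC// PB subee.
have : P (~` (A `&` B)) = 0%E.
  apply/eqP; rewrite eq_le measure_ge0 andbT setCI.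
  apply: le_trans (measureU2 _ _ _) _; [exact: measurableC|exact: measurableC|].
  have -> : (P (~` A) + P (~` B) = 0)%E by rewrite cA cB adde0.
  by [].
rewrite -{2}(setCK (A `&` B)) => c0.
by rewrite probability_setC ?c0 ?sube0//; apply/measurableC/measurableI.
Qed.

Lemma prob1_nonempty (A : set T) : P A = 1%E -> exists x, A x.
Proof.
move=> PA; apply: contrapT => h; have A0 : A = set0.
  by apply/seteqP; split => // x Ax; apply: h; exists x.
by move: PA; rewrite A0 measure0 => /eqP; rewrite eqe eq_sym oner_eq0.
Qed.

Lemma bmeas_restrict (A : set T) (g : T -> R) (M : R) : measurable A ->
  measurable_fun setT g -> (forall x, A x -> `|g x| <= M) ->
  bmeas (fun x => \1_A x * g x).
Proof.
move=> mA mg gM; split.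
  by apply: measurable_funM => //; exact: measurable_indic.
exists `|M| => x; rewrite indicE; case: (boolP (x \in A)) => [/set_mem Ax|_].
  by rewrite mul1r; exact: le_trans (gM x Ax) (ler_norm _).
by rewrite mul0r normr0.
Qed.

End ProbabilityOne.

Lemma Rint_law (R : realType) (dO dT : measure_display)
    (Omega : measurableType dO) (T : measurableType dT)
    (P : probability Omega R) (nu : probability T R) (X : Omega -> T)
    (f : T -> R) :
  measurable_fun setT X -> (forall B, measurable B -> P (X @^-1` B) = nu B) ->
  bmeas f -> \int[P]_w f (X w) = \int[nu]_x f x.
Proof.
move=> mX PX bf; have [mf _] := bf.
have mEf : measurable_fun setT (EFin \o f) by exact/measurable_EFinP.
have iX := bmeas_integrable P (bmeas_comp mX bf).
have := @integral_pushforward _ _ _ _ R X mX P setT (EFin \o f) mEf iX measurableT.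
rewrite preimage_setT => H; congr fine; apply: etrans (esym H) _.
by apply: eq_measure_integral => A mA _; exact: PX.
Qed.

Section SymmetricMoments.
Context {R : realType} {K : nat} (nu : probability (K.-tuple R) R).
Hypothesis K1 : (1 < K)%N.
Hypothesis nu_sym : symmetric_measure nu.
Variables mu rho beta : R.

Definition gap_set (k : 'I_K) : set (K.-tuple R) :=
  [set x | norm2 (tvec x) = 1 /\ gapped mu rho beta (tvec x) k].

Lemma measurable_unit_sphere :
  measurable [set x : K.-tuple R | norm2 (tvec x) = 1].
Proof.
rewrite (_ : [set _ | _] = (fun x => norm2 (tvec x)) @^-1` [set 1])//.
by rewrite -[X in measurable X]setTI; apply: measurable_norm2.
Qed.

Lemma measurable_gapped k :
  measurable [set x : K.-tuple R | gapped mu rho beta (tvec x) k].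
Proof.
apply: (@fin_bigcap_measurable _ _ _ [set j | j != k] (fun j =>
    ([set x | `|tvec x j| < `|tvec x k|] `&`
     [set x | `|tvec x j| + mu * (\sum_i `|tvec x i|) + rho <=
              beta * (`|tvec x k| - `|tvec x j|)]))) => [|j _].
  exact: finite_finset.
apply: measurableI.
  have mb := measurable_fun_ltr (@measurable_abs_coord R K j)
    (measurable_abs_coord k).
  by have := mb measurableT [set true] I; rewrite setTI.
rewrite -[X in measurable X]setTI; apply: measurable_fun_le => //.
  apply: measurable_funD => //; apply: measurable_funD.
    exact: measurable_abs_coord.
  apply: measurable_funM => //; exact: measurable_norm1.
apply: measurable_funM => //; apply: measurable_funB; exact: measurable_abs_coord.
Qed.

Lemma measurable_gap_set k : measurable (gap_set k).
Proof.
by apply: measurableI; [exact: measurable_unit_sphere|exact: measurable_gapped].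
Qed.

Lemma gap_set_bound k x j : gap_set k x -> `|tnth x j| <= 1.
Proof. by move=> [x1 _]; rewrite -x1; exact: (abs_coord_le (tvec x)). Qed.

Lemma bmeas_gap1 k j : bmeas (fun x : K.-tuple R => \1_(gap_set k) x * tnth x j).
Proof.
apply: (@bmeas_restrict _ _ _ _ _ 1); first exact: measurable_gap_set.
  exact: measurable_coord.
by move=> x gx; exact: gap_set_bound gx.
Qed.

Lemma bmeas_gap2 k j l :
  bmeas (fun x : K.-tuple R => \1_(gap_set k) x * (tnth x j * tnth x l)).
Proof.
apply: (@bmeas_restrict _ _ _ _ _ 1); first exact: measurable_gap_set.
  by apply: measurable_funM; exact: measurable_coord.
by move=> x gx; rewrite normrM mulr_ile1 ?(gap_set_bound _ gx).
Qed.

Definition signed_perm (s : 'I_K -> bool) (sigma : 'S_K) (x : K.-tuple R) :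
  K.-tuple R := [tuple (if s i then -1 else 1) * tnth x (sigma i) | i < K].

Lemma measurable_signed_perm s sigma : measurable_fun setT (signed_perm s sigma).
Proof.
apply/measurable_fun_tnthP => i.
rewrite (_ : _ \o _ = fun x => (if s i then -1 else 1) * tnth x (sigma i)).
  by apply: measurable_funM => //; exact: measurable_coord.
by apply/funext => x /=; rewrite tnth_mktuple.
Qed.

Lemma Rint_signed_perm s sigma f : bmeas f ->
  \int[nu]_x f (signed_perm s sigma x) = \int[nu]_x f x.
Proof.
move=> bf; apply: Rint_law => //; first exact: measurable_signed_perm.
by move=> B mB; exact: nu_sym.
Qed.

(** Up to sign, the entry at [k] after the action is the entry at [sigma k] before it, so the
    dominant index is carried along. *)
Lemma gap_set_signed_perm s (sigma : 'S_K) k x :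
  gap_set k (signed_perm s sigma x) <-> gap_set (sigma k) x.
Proof.
have ab i : `|tvec (signed_perm s sigma x) i| = `|tvec x (sigma i)|.
  by rewrite /tvec tnth_mktuple normrM; case: (s i); rewrite ?normrN normr1 mul1r.
have nE : norm2 (tvec (signed_perm s sigma x)) = norm2 (tvec x).
  rewrite /norm2 [in RHS](reindex_inj (@perm_inj _ sigma)) /=.
  congr Num.sqrt; apply: eq_bigr => i _.
  by rewrite -real_normK ?num_real// ab real_normK ?num_real.
have sE : \sum_i `|tvec (signed_perm s sigma x) i| = \sum_i `|tvec x i|.
  rewrite [in RHS](reindex_inj (@perm_inj _ sigma)) /=; exact: eq_bigr.
rewrite /gap_set /= nE /gapped; split=> -[x1 g]; split=> // j jk.
  have := g ((sigma^-1)%g j); rewrite sE !ab permKV; apply.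
  by apply: contraNneq jk => <-; rewrite permKV.
by rewrite sE !ab; apply: g; rewrite (inj_eq perm_inj).
Qed.

Lemma indic_gap_signed_perm s (sigma : 'S_K) k x :
  \1_(gap_set k) (signed_perm s sigma x) = \1_(gap_set (sigma k)) x :> R.
Proof.
rewrite !indicE; congr ((nat_of_bool _)%:R).
by apply/idP/idP => /set_mem H; apply/mem_set; apply/(gap_set_signed_perm s).
Qed.

Definition gap_moment k j l : R :=
  \int[nu]_x (\1_(gap_set k) x * (tnth x j * tnth x l)).

Definition gap_mass k : R := \int[nu]_x (\1_(gap_set k) x : R).

Lemma gap_moment_perm (sigma : 'S_K) k j l :
  gap_moment (sigma k) (sigma j) (sigma l) = gap_moment k j l.
Proof.
rewrite /gap_moment -(Rint_signed_perm (fun=> false) sigma (bmeas_gap2 k j l)).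
apply: eq_Rintegral => x _; rewrite indic_gap_signed_perm.
by rewrite !tnth_mktuple !mul1r.
Qed.

Lemma gap_moment_off k j l : j != l -> gap_moment k j l = 0.
Proof.
(* Flipping the sign of coordinate [j] alone preserves [nu] and the gap set but negates the
   integrand. *)
move=> jl; pose s i := i == j.
have : gap_moment k j l = - gap_moment k j l.
  rewrite {1}/gap_moment -(Rint_signed_perm s 1%g (bmeas_gap2 k j l)).
  rewrite -RintN; last exact: bmeas_gap2.
  apply: eq_Rintegral => x _; rewrite indic_gap_signed_perm perm1.
  rewrite !tnth_mktuple !perm1 /s eqxx eq_sym (negbTE jl); ring.
by lra.
Qed.

Lemma gap_mass_perm (sigma : 'S_K) k : gap_mass (sigma k) = gap_mass k.
Proof.
have b : bmeas (\1_(gap_set k) : K.-tuple R -> R).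
  by apply: bmeas_indic; exact: measurable_gap_set.
rewrite /gap_mass -(Rint_signed_perm (fun=> false) sigma b).
by apply: eq_Rintegral => x _; rewrite indic_gap_signed_perm.
Qed.

Lemma gap_mass_const k k' : gap_mass k = gap_mass k'.
Proof. by rewrite -(gap_mass_perm (tperm k k') k) tpermL. Qed.

Lemma gap_moment_diag_const k k' : gap_moment k k k = gap_moment k' k' k'.
Proof. by rewrite -(gap_moment_perm (tperm k k') k k k) tpermL. Qed.

Lemma gap_moment_side_const k j j' : j != k -> j' != k ->
  gap_moment k j j = gap_moment k j' j'.
Proof.
move=> jk j'k; rewrite -(gap_moment_perm (tperm j j') k j j) tpermL.
by rewrite tpermD// eq_sym.
Qed.

Lemma gap_set_disj k k' x : gap_set k x -> gap_set k' x -> k = k'.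
Proof. by move=> [_ g] [_ g']; exact: gapped_inj g g'. Qed.

Lemma sum_indic_gap x k : gap_set k x -> forall F : 'I_K -> R,
  \sum_i \1_(gap_set i) x * F i = F k.
Proof.
move=> gk F; rewrite (bigD1 k)//= indicE mem_set// mul1r big1 ?addr0// => i ik.
rewrite indicE memNset ?mul0r// => gi.
by move/eqP: ik; apply; exact: gap_set_disj gi gk.
Qed.

Hypothesis nu_gap : nu (\bigcup_k gap_set k) = 1%E.
Variable c1bar : R.
Hypothesis nu_c1 :
  (\int[nu]_x ((normInf (tvec x)) ^+ 2)%:E = (c1bar ^+ 2)%:E)%E.

Let mU : measurable (\bigcup_k gap_set k).
Proof. by apply: fin_bigcup_measurable => // k _; exact: measurable_gap_set. Qed.

Let K0 : (K%:R : R) != 0.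
Proof. by rewrite pnatr_eq0 -lt0n (leq_trans _ K1). Qed.

(** The gap sets are disjoint, cover almost everything, and have equal mass by permutation
    symmetry. *)
Lemma gap_massE k : gap_mass k = K%:R^-1.
Proof.
have b i : bmeas (\1_(gap_set i) : K.-tuple R -> R).
  by apply: bmeas_indic; exact: measurable_gap_set.
have : \sum_i gap_mass i = 1.
  rewrite /gap_mass -Rint_sum// -[RHS](Rint_cst nu).
  apply: (@Rint_ae _ _ _ nu _ _ (\bigcup_k gap_set k)) => //.
    by have [] := bmeas_sum b.
  move=> x [i _ gi]; rewrite -(sum_indic_gap gi (fun=> 1)).
  by apply: eq_bigr => j _; rewrite mulr1.
rewrite (eq_bigr (fun=> gap_mass k)); last by move=> i _; exact: gap_mass_const.
rewrite sumr_const card_ord => E.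
by apply: (mulfI K0); rewrite mulr_natl E mulfV.
Qed.

(** Summed over [k], these moments give the mean of the squared sup norm, and symmetry makes them
    equal. *)
Lemma gap_moment_diagE k : gap_moment k k k = c1bar ^+ 2 / K%:R.
Proof.
have nI : \int[nu]_x (normInf (tvec x) ^+ 2) = c1bar ^+ 2.
  by rewrite /Rintegral nu_c1.
have mI : measurable_fun setT (fun x : K.-tuple R => normInf (tvec x) ^+ 2).
  apply: measurable_funX; rewrite /normInf.
  elim: (index_enum _) => [|i s IH].
    by under eq_fun do rewrite big_nil; exact: measurable_cst.
  under eq_fun do rewrite big_cons.
  by apply: measurable_maxr => //; exact: measurable_abs_coord.
have : \sum_i gap_moment i i i = c1bar ^+ 2.
  rewrite /gap_moment -Rint_sum; last by move=> i; exact: bmeas_gap2.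
  rewrite -nI; apply: (@Rint_ae _ _ _ nu _ _ (\bigcup_k gap_set k)) => //.
    by have [] := bmeas_sum (fun i => bmeas_gap2 i i i).
  move=> x [i _ gi]; rewrite (sum_indic_gap gi (fun j => tnth x j * tnth x j)).
  by have [_ g] := gi; rewrite (normInf_gapped g) real_normK ?num_real.
rewrite (eq_bigr (fun=> gap_moment k k k)); last first.
  by move=> i _; exact: gap_moment_diag_const.
rewrite sumr_const card_ord => E.
by apply: (mulfI K0); rewrite mulr_natl E mulrCA mulfV// mulr1.
Qed.

(** On the unit sphere the squares sum to 1, so the moments over all [j] add up to the mass [1/K].
    What the diagonal moment leaves is shared equally by the other [K - 1] indices. *)
Lemma gap_moment_sideE k j : j != k ->
  gap_moment k j j = (1 - c1bar ^+ 2) / (K%:R - 1) / K%:R.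
Proof.
move=> jk.
have : \sum_i gap_moment k i i = K%:R^-1.
  rewrite /gap_moment -Rint_sum; last by move=> i; exact: bmeas_gap2.
  rewrite -(gap_massE k) /gap_mass; apply: eq_Rintegral => x _.
  rewrite -mulr_sumr indicE; case: (boolP (x \in _)) => [/set_mem[x1 _]|_].
    rewrite mul1r -[LHS]/(dotv (tvec x) (tvec x)) -sqr_norm2 x1 expr1n //.
  by rewrite mul0r.
rewrite (bigD1 k)//= gap_moment_diagE (eq_bigr (fun=> gap_moment k j j)).
  rewrite sumr_const cardC1 card_ord.
  have KE : (K.-1%:R : R) = K%:R - 1.
    by rewrite -[in RHS](prednK (ltnW K1)) -natr1 addrK.
  have K1' : (K%:R - 1 : R) != 0.
    by rewrite subr_eq0 (eqr_nat _ K 1) gt_eqF.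
  move=> E; apply: (mulfI K1').
  rewrite [RHS]mulrA (mulrC (K%:R - 1) (_ / _)) divfK//.
  by rewrite -KE mulr_natl mulrBl mul1r -[X in _ = X - _]E addrAC subrr add0r.
by move=> i ik; exact: gap_moment_side_const.
Qed.

End SymmetricMoments.

(** * Second moments of the signals *)

Section NoiseBall.
Context {R : realType} {d : nat} (rho_max : R).

Definition noise_ball : set (d.-tuple R) := [set r | norm2 (tvec r) <= rho_max].

Lemma measurable_noise_ball : measurable noise_ball.
Proof.
rewrite -[noise_ball]setTI; apply: measurable_fun_le => //; exact: measurable_norm2.
Qed.

Lemma bmeas_noise1 i : bmeas (fun r : d.-tuple R => \1_noise_ball r * tnth r i).
Proof.
apply: (@bmeas_restrict _ _ _ _ _ rho_max); first exact: measurable_noise_ball.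
  exact: measurable_coord.
by move=> r rb; apply: le_trans rb; exact: (abs_coord_le (tvec r)).
Qed.

Lemma bmeas_noise2 i j :
  bmeas (fun r : d.-tuple R => \1_noise_ball r * (tnth r i * tnth r j)).
Proof.
apply: (@bmeas_restrict _ _ _ _ _ (rho_max * rho_max)).
- exact: measurable_noise_ball.
- by apply: measurable_funM; exact: measurable_coord.
move=> r rb; rewrite normrM ler_pM//; apply: le_trans rb;
  exact: (abs_coord_le (tvec r)).
Qed.

End NoiseBall.

Section SecondMoments.
Context {R : realType} {d K : nat} (Phi : 'I_K -> 'I_d -> R).
Variables (rho_max beta : R).

Let gset := @gap_set R K (coherence Phi) rho_max beta.
Let nball := @noise_ball R d rho_max.

(* The summand of the empirical second moment matrix of the signals whose
   dominant coefficient is the k-th one, cut off on a null set so that it is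
   bounded everywhere. *)
Definition top_product (k : 'I_K) (u v : 'I_d -> R)
    (z : K.-tuple R * d.-tuple R) : R :=
  \1_(gset k) z.1 * \1_nball z.2 *
  (dotv u (signal Phi (tvec z.1) (tvec z.2)) *
   dotv v (signal Phi (tvec z.1) (tvec z.2))).

Lemma measurable_dotv_signal u : measurable_fun setT
  (fun z : K.-tuple R * d.-tuple R => dotv u (signal Phi (tvec z.1) (tvec z.2))).
Proof.
apply: measurable_sum => i; apply: measurable_funM => //.
apply: measurable_funD.
  apply: measurable_sum => k; apply: measurable_funM => //.
  exact: (measurableT_comp (measurable_coord k) measurable_fst).
exact: (measurableT_comp (measurable_coord i) measurable_snd).
Qed.

Lemma measurable_top_product k u v : measurable_fun setT (top_product k u v).
Proof.
apply: measurable_funM; last first.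
  by apply: measurable_funM; exact: measurable_dotv_signal.
apply: measurable_funM.
  apply: (@measurableT_comp _ _ _ _ _ _ (\1_(gset k) : _ -> R) _ fst).
    by apply: measurable_indic; exact: measurable_gap_set.
  exact: measurable_fst.
apply: (@measurableT_comp _ _ _ _ _ _ (\1_nball : _ -> R) _ snd).
  by apply: measurable_indic; exact: measurable_noise_ball.
exact: measurable_snd.
Qed.

(** Bounding only the [u] factor in the square leaves the second moment along [v]. For mixed entries
    [v] is taken orthogonal to [phi_k], where this moment is small. *)
Lemma top_product_bound k u v (M L : R) : 0 <= M -> 0 <= L ->
  (forall x r, gset k x -> nball r ->
    `|dotv u (signal Phi (tvec x) (tvec r))| <= M /\
    `|dotv v (signal Phi (tvec x) (tvec r))| <= L) ->
  forall z, `|top_product k u v z| <= M * L /\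
            top_product k u v z ^+ 2 <= M ^+ 2 * top_product k v v z.
Proof.
move=> M0 L0 H [x r]; rewrite /top_product /= !indicE.
have ML : 0 <= M * L by rewrite mulr_ge0.
case: (boolP (x \in _)) => [/set_mem gx|_]; last first.
  by rewrite !mul0r normr0 expr0n mulr0.
case: (boolP (r \in _)) => [/set_mem br|_]; last first.
  by rewrite mulr0 !mul0r normr0 expr0n mulr0.
have [uM vL] := H x r gx br.
rewrite !mulr1 !mul1r normrM ler_pM//; split=> //.
rewrite exprMn -expr2 ler_wpM2r ?sqr_ge0// -real_normK ?num_real//.
by rewrite ler_pXn2r ?nnegrE.
Qed.

(** Every term is a bounded function of [x] times a bounded function of [r], the form in which
    independence applies; the two cutoffs are distributed accordingly. *)
Lemma top_product_expand k u v (x : K.-tuple R) (r : d.-tuple R) :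
  top_product k u v (x, r) =
  \sum_j \sum_l (dotv u (Phi j) * dotv v (Phi l)) *
    ((\1_(gset k) x * (tnth x j * tnth x l)) * \1_nball r) +
  \sum_j \sum_i (dotv u (Phi j) * v i + dotv v (Phi j) * u i) *
    ((\1_(gset k) x * tnth x j) * (\1_nball r * tnth r i)) +
  \sum_i \sum_j (u i * v j) *
    (\1_(gset k) x * (\1_nball r * (tnth r i * tnth r j))).
Proof.
rewrite /top_product /= !dotv_signal.
set s := \1_(gset k) x; set q := \1_nball r.
set a := \sum_j _ * dotv u (Phi j); set b := \sum_j _ * dotv v (Phi j).
have -> : s * q * ((a + dotv u (tvec r)) * (b + dotv v (tvec r))) =
  s * q * (a * b) + s * q * (a * dotv v (tvec r) + b * dotv u (tvec r)) +
  s * q * (dotv u (tvec r) * dotv v (tvec r)) by ring.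
congr (_ + _ + _).
- rewrite /a /b big_distrlr /= mulr_sumr; apply: eq_bigr => j _.
  by rewrite mulr_sumr; apply: eq_bigr => l _; rewrite /tvec; ring.
- rewrite /a /b /dotv !big_distrlr /= -big_split /= mulr_sumr.
  apply: eq_bigr => j _; rewrite -big_split /= mulr_sumr.
  by apply: eq_bigr => i _; rewrite /tvec; ring.
- rewrite /dotv big_distrlr /= mulr_sumr; apply: eq_bigr => j _.
  by rewrite mulr_sumr; apply: eq_bigr => l _; rewrite /tvec; ring.
Qed.

Context {dO : measure_display} {Omega : measurableType dO}
  (P : probability Omega R) (nu : probability (K.-tuple R) R)
  (X : Omega -> K.-tuple R) (N : Omega -> d.-tuple R).
Variables (A rho c1bar : R).
Hypothesis K1 : (1 < K)%N.
Hypothesis mX : measurable_fun setT X.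
Hypothesis mN : measurable_fun setT N.
Hypothesis frame : unit_norm_tight_frame Phi A.
Hypothesis ind : indep2 P X N.
Hypothesis N_bound : P [set w | norm2 (tvec (N w)) <= rho_max] = 1%E.
Hypothesis N_mean : forall i, ('E_P[fun w => tnth (N w) i] = 0)%E.
Hypothesis N_cov : forall i j,
  ('E_P[fun w => (tnth (N w) i * tnth (N w) j)%R]
     = (if i == j then rho ^+ 2 else 0)%:E)%E.
Hypothesis X_law : forall B, measurable B -> P (X @^-1` B) = nu B.
Hypothesis nu_sym : symmetric_measure nu.
Hypothesis nu_gap : nu (\bigcup_k gset k) = 1%E.
Hypothesis nu_c1 :
  (\int[nu]_x ((normInf (tvec x)) ^+ 2)%:E = (c1bar ^+ 2)%:E)%E.

Let mNb : measurable (N @^-1` nball).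
Proof. by rewrite -[X in measurable X]setTI; apply: mN => //; exact: measurable_noise_ball. Qed.

Let b_nball : bmeas (\1_nball : d.-tuple R -> R).
Proof. by apply: bmeas_indic; exact: measurable_noise_ball. Qed.

Let b_gset k : bmeas (\1_(gset k) : K.-tuple R -> R).
Proof. by apply: bmeas_indic; exact: measurable_gap_set. Qed.

(** The moments of the noise are given without truncation; the noise ball has probability one, so
    its indicator can be inserted freely. *)
Let cut (g : d.-tuple R -> R) : measurable_fun setT g ->
  \int[P]_w (\1_nball (N w) * g (N w)) = \int[P]_w g (N w).
Proof.
move=> mg; apply: (@Rint_ae _ _ _ P _ _ (N @^-1` nball)) => //.
- apply: measurable_funM; last exact: measurableT_comp.
  by apply: measurableT_comp => //; apply: measurable_indic; exact: measurable_noise_ball.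
- exact: measurableT_comp.
- by move=> w Nw; rewrite indicE mem_set// mul1r.
Qed.

Lemma Rint_noise0 : \int[P]_w (\1_nball (N w) : R) = 1.
Proof.
have m1 : measurable_fun setT (fun _ : d.-tuple R => 1 : R) by exact: measurable_cst.
have := cut m1; rewrite Rint_cst => <-; by apply: eq_Rintegral => w _; rewrite mulr1.
Qed.

Lemma Rint_noise1 i : \int[P]_w (\1_nball (N w) * tnth (N w) i) = 0.
Proof.
rewrite (cut (measurable_coord i)); have := N_mean i.
by rewrite unlock /Rintegral => ->.
Qed.

Lemma Rint_noise2 i j :
  \int[P]_w (\1_nball (N w) * (tnth (N w) i * tnth (N w) j)) =
  if i == j then rho ^+ 2 else 0.
Proof.
rewrite (@cut (fun r => tnth r i * tnth r j)); last first.
  by apply: measurable_funM; exact: measurable_coord.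
by have := N_cov i j; rewrite unlock /Rintegral => ->.
Qed.

(** The left side is the trace of the covariance, that is, the mean of [|r|^2]. *)
Lemma noise_variance_le : d%:R * rho ^+ 2 <= rho_max ^+ 2.
Proof.
have bi i : bmeas (fun w => \1_nball (N w) * (tnth (N w) i * tnth (N w) i)).
  exact: (bmeas_comp mN (bmeas_noise2 rho_max i i)).
have -> : d%:R * rho ^+ 2 =
    \int[P]_w (\sum_i \1_nball (N w) * (tnth (N w) i * tnth (N w) i)).
  rewrite Rint_sum// (eq_bigr (fun=> rho ^+ 2)); last first.
    by move=> i _; rewrite Rint_noise2 eqxx.
  by rewrite sumr_const card_ord mulr_natl.
rewrite -[leRHS](Rint_cst P); apply: Rint_le; first exact: bmeas_sum.
  exact: bmeas_cst.
move=> w; rewrite -mulr_sumr indicE.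
case: (boolP (_ \in _)) => [/set_mem nb|_]; last by rewrite mul0r sqr_ge0.
rewrite mul1r -[leLHS]/(dotv (tvec (N w)) (tvec (N w))) -sqr_norm2.
rewrite ler_pXn2r ?nnegrE ?norm2_ge0//; exact: le_trans (norm2_ge0 _) nb.
Qed.

Definition lambda_of := c1bar ^+ 2 - (1 - c1bar ^+ 2) / (K%:R - 1).
Definition sigma_of := ((1 - c1bar ^+ 2) / (K%:R - 1) * A + rho ^+ 2) / K%:R.

(** The cross terms vanish because the noise is centred, and sign symmetry kills the off-diagonal
    coefficient moments. The diagonal is a constant plus an excess at [k]: the constant part sums to
    a multiple of [A <u, v>] by tightness, the excess gives the rank-one term. *)
Lemma top_product_mean k u v :
  \int[P]_w top_product k u v (X w, N w) =
  lambda_of / K%:R * (dotv u (Phi k) * dotv v (Phi k)) + sigma_of * dotv u v.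
Proof.
have bX (f : K.-tuple R -> R) : bmeas f -> bmeas (fun w => f (X w)) by exact: bmeas_comp.
have bN (f : d.-tuple R -> R) : bmeas f -> bmeas (fun w => f (N w)) by exact: bmeas_comp.
have g1 j := @bmeas_gap1 R K (coherence Phi) rho_max beta k j.
have g2 j l := @bmeas_gap2 R K (coherence Phi) rho_max beta k j l.
have n1 i := @bmeas_noise1 R d rho_max i.
have n2 i j := @bmeas_noise2 R d rho_max i j.
have bc (c : R) : bmeas (fun w : Omega => c) by exact: bmeas_cst.
pose T1 j l w := (\1_(gset k) (X w) * (tnth (X w) j * tnth (X w) l)) * \1_nball (N w).
pose T2 j i w := (\1_(gset k) (X w) * tnth (X w) j) *
                 (\1_nball (N w) * tnth (N w) i).
pose T3 i j w := \1_(gset k) (X w) *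
                 (\1_nball (N w) * (tnth (N w) i * tnth (N w) j)).
have bT1 j l : bmeas (T1 j l) by exact: (bmeasM (bX _ (g2 j l)) (bN _ b_nball)).
have bT2 j i : bmeas (T2 j i) by exact: (bmeasM (bX _ (g1 j)) (bN _ (n1 i))).
have bT3 i j : bmeas (T3 i j) by exact: (bmeasM (bX _ (b_gset k)) (bN _ (n2 i j))).
have E1 j l : \int[P]_w T1 j l w = gap_moment nu (coherence Phi) rho_max beta k j l.
  rewrite (indep2_Rint mX mN ind (g2 j l) b_nball) Rint_noise0 mulr1.
  exact: Rint_law.
have E2 j i : \int[P]_w T2 j i w = 0.
  by rewrite (indep2_Rint mX mN ind (g1 j) (n1 i)) Rint_noise1 mulr0.
have E3 i j : \int[P]_w T3 i j w = K%:R^-1 * (if i == j then rho ^+ 2 else 0).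
  rewrite (indep2_Rint mX mN ind (b_gset k) (n2 i j)) Rint_noise2; congr (_ * _).
  rewrite (Rint_law mX X_law (b_gset k)).
  exact: (gap_massE K1 nu_sym nu_gap).
have dsum (I J : finType) (c : I -> J -> R) (T : I -> J -> Omega -> R) :
    (forall i j, bmeas (T i j)) ->
    bmeas (fun w => \sum_i \sum_j c i j * T i j w) /\
    \int[P]_w (\sum_i \sum_j c i j * T i j w) =
    \sum_i \sum_j c i j * \int[P]_w T i j w.
  move=> bT.
  have bij i j : bmeas (fun w => c i j * T i j w) by exact: bmeasM (bc _) (bT i j).
  have bi i : bmeas (fun w => \sum_j c i j * T i j w) by exact: bmeas_sum.
  split; first exact: bmeas_sum.
  rewrite Rint_sum//; apply: eq_bigr => i _; rewrite Rint_sum//.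
  by apply: eq_bigr => j _; rewrite RintZ.
under eq_Rintegral do rewrite top_product_expand.
have [b1 I1] := dsum _ _ (fun j l => dotv u (Phi j) * dotv v (Phi l)) _ bT1.
have [b2 I2] := dsum _ _ (fun j i => dotv u (Phi j) * v i + dotv v (Phi j) * u i) _ bT2.
have [b3 I3] := dsum _ _ (fun i j => u i * v j) _ bT3.
rewrite RintD//; last exact: (bmeasD b1 b2).
rewrite RintD// I1 I2 I3.
rewrite [X in _ + X + _]big1 ?addr0; last first.
  by move=> j _; rewrite big1// => i _; rewrite E2 mulr0.
have -> : \sum_i \sum_j u i * v j * \int[P]_w T3 i j w =
    K%:R^-1 * rho ^+ 2 * dotv u v.
  rewrite /dotv mulr_sumr; apply: eq_bigr => i _.
  rewrite (bigD1 i)//= E3 eqxx big1 ?addr0; first by ring.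
  by move=> j /negbTE ji; rewrite E3 eq_sym ji !mulr0.
have -> : \sum_j \sum_l dotv u (Phi j) * dotv v (Phi l) * \int[P]_w T1 j l w =
   \sum_j dotv u (Phi j) * dotv v (Phi j) *
     gap_moment nu (coherence Phi) rho_max beta k j j.
  apply: eq_bigr => j _; rewrite (bigD1 j)//= E1 big1 ?addr0// => l lj.
  by rewrite E1 gap_moment_off ?mulr0// eq_sym.
have -> : \sum_j dotv u (Phi j) * dotv v (Phi j) *
     gap_moment nu (coherence Phi) rho_max beta k j j =
   lambda_of / K%:R * (dotv u (Phi k) * dotv v (Phi k)) +
   (1 - c1bar ^+ 2) / (K%:R - 1) / K%:R *
     \sum_j dotv u (Phi j) * dotv v (Phi j).
  rewrite (bigD1 k)//= (gap_moment_diagE K1 nu_sym nu_gap nu_c1).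
  rewrite [X in _ = _ + _ * X](bigD1 k)//= mulrDr [X in _ = _ + (_ + X)]mulr_sumr.
  rewrite addrA; congr (_ + _).
    by rewrite /lambda_of; ring.
  apply: eq_bigr => j jk.
  by rewrite (gap_moment_sideE K1 nu_sym nu_gap nu_c1 jk) mulrC.
rewrite (frame_polar u v frame) /sigma_of; ring.
Qed.

End SecondMoments.

(** * Constants *)

Section SpectralGap.
Context {R : realType} {K : nat} (nu : probability (K.-tuple R) R).

Lemma spectral_gap_bounds (mu rho beta c1bar : R) :
  (1 < K)%N -> symmetric_measure nu -> 0 <= mu -> 0 <= rho -> beta < 1 / 2 ->
  nu (\bigcup_k gap_set mu rho beta k) = 1%E ->
  (\int[nu]_x ((normInf (tvec x)) ^+ 2)%:E = (c1bar ^+ 2)%:E)%E ->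
  let tau := (1 - c1bar ^+ 2) / (K%:R - 1) in
  [/\ 0 <= tau, tau <= K%:R^-1, 0 < c1bar ^+ 2 - tau & c1bar ^+ 2 - tau <= 1].
Proof.
move=> K1 sym mu0 rho0 b gap c1 tau.
pose k := Ordinal (ltnW K1); pose j := Ordinal K1.
have jk : j != k by [].
have Kp : (0 : R) < K%:R by rewrite ltr0n (ltnW K1).
have Km : (0 : R) < K%:R - 1 by rewrite subr_gt0 ltr1n.
have dE := gap_moment_diagE K1 sym gap c1 k.
have sE := gap_moment_sideE K1 sym gap c1 jk.
have mE := gap_massE K1 sym gap k.
have bm := @bmeas_gap2 R K mu rho beta.
have bi : bmeas (\1_(gap_set mu rho beta k) : K.-tuple R -> R).
  by apply: bmeas_indic; exact: measurable_gap_set.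
have c_le1 : c1bar ^+ 2 <= 1.
  have : c1bar ^+ 2 / K%:R <= K%:R^-1.
    rewrite -dE -mE; apply: Rint_le => // x; rewrite indicE.
    case: (boolP (x \in _)) => [/set_mem gx|_]; last by rewrite !mul0r.
    rewrite mul1r; apply: le_trans (ler_norm _) _; rewrite normrM.
    by rewrite mulr_ile1 ?(gap_set_bound _ gx).
  by rewrite ler_pdivrMr// mulVf ?gt_eqF.
have tau0 : 0 <= tau by rewrite divr_ge0 ?(ltW Km)// subr_ge0.
(* On the gap set of [k] the other coefficients are at most a third of [|x_k|]; squaring and
   integrating gives the factor 9. *)
have t9 : 9 * tau <= c1bar ^+ 2.
  have : 9 * (tau / K%:R) <= c1bar ^+ 2 / K%:R.
    rewrite -sE -dE /gap_moment -RintZ//; apply: Rint_le => //.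
      by apply: bmeasM => //; exact: bmeas_cst.
    move=> x; rewrite indicE; case: (boolP (x \in _)) => [/set_mem gx|_]; last first.
      by rewrite !mul0r mulr0.
    rewrite !mul1r; have [_ g] := gx.
    have h3 := gapped_ratio g mu0 rho0 b jk; rewrite /tvec in h3.
    rewrite -!expr2 -[tnth x j ^+ 2]real_normK ?num_real//.
    rewrite -[tnth x k ^+ 2]real_normK ?num_real//.
    have -> : 9 * `|tnth x j| ^+ 2 = (3 * `|tnth x j|) ^+ 2 by ring.
    by rewrite ler_pXn2r ?nnegrE ?mulr_ge0.
  by rewrite mulrA ler_pM2r ?invr_gt0.
have tK : (K%:R - 1) * tau = 1 - c1bar ^+ 2.
  by rewrite /tau mulrC divfK ?gt_eqF.
have c_ge : tau <= c1bar ^+ 2 by lra.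
(* Adding [tau <= c1bar^2] to [(K - 1) tau = 1 - c1bar^2] gives [K tau <= 1]. *)
have tauK : tau <= K%:R^-1.
  by rewrite -[leRHS]mul1r ler_pdivlMr//; move: tK c_ge; lra.
have c_gt0 : 0 < c1bar ^+ 2.
  rewrite lt_neqAle sqr_ge0 andbT; apply/eqP => c0.
  have t00 : tau = 0 by apply/eqP; rewrite eq_le tau0 andbT; lra.
  by move: tK; rewrite t00 -c0; lra.
by split=> //; lra.
Qed.

End SpectralGap.

Lemma union_bound (R : realType) (dT : measure_display) (T : measurableType dT)
    (P : probability T R) (I : finType) (A : I -> set T) (c : R) :
  (forall i, measurable (A i)) -> (forall i, (P (A i) <= c%:E)%E) ->
  measurable (\bigcup_i A i) /\ (P (\bigcup_i A i) <= (#|I|%:R * c)%:E)%E.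
Proof.
move=> mA PA.
have -> : \bigcup_i A i = \big[setU/set0]_(i <- enum I) A i.
  rewrite -bigcup_seq; apply/seteqP; split => x [i] => [_|/=] Ai; exists i => //=.
  by rewrite mem_enum.
rewrite cardE; elim: (enum I) => [|i s [mS IH]].
  by rewrite big_nil mul0r; split => //; rewrite measure0.
rewrite big_cons; split; first exact: measurableU.
apply: le_trans (measureU2 _ _ _) _ => //.
rewrite /= -natr1 mulrDl mul1r [X in (_ <= X%:E)%E]addrC EFinD; apply: leeD; [exact: PA|exact: IH].
Qed.

(** The left side counts the [K (d + 1)^2] matrix entries, doubled for the two tails. As
    [d + 1 <= 2^(2d - 1)], it is at most [(2K)^(2d)], and [2d <= K d]. *)
Lemma index_count (R : realType) (d K : nat) (y : R) :
  (0 < d)%N -> (1 < K)%N -> 2 * K%:R <= y ->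
  2 * (K * (d.+1 * d.+1))%:R <= expR (K%:R * d%:R * ln y).
Proof.
move=> d0 K1 Ky; have K2 : 2 <= K%:R :> R by rewrite (ler_nat _ 2).
have y0 : 0 < y by lra.
have -> : expR (K%:R * d%:R * ln y) = y ^+ (K * d).
  by rewrite -natrM mulrC expRM_natr lnK.
have hn : (2 * (K * (d.+1 * d.+1)) <= (2 * K) ^ (2 * d))%N.
  case: d d0 => // d _; rewrite mulnA.
  have -> : (2 * d.+1 = (2 * d).+2)%N by rewrite mulnS.
  rewrite expnS leq_mul2l; apply/orP; right.
  apply: (@leq_trans (4 ^ (2 * d).+1)); last by rewrite leq_exp2r// (leq_mul2l 2 2).
  have h : (d.+2 <= 2 ^ (2 * d).+1)%N.
    apply: (@leq_trans (2 ^ d.+1)); first exact: ltn_expl.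
    by rewrite leq_exp2l// ltnS leq_pmull.
  by rewrite (_ : 4 = 2 * 2)%N// expnMn leq_mul.
apply: (@le_trans _ _ ((2 * K)%:R ^+ (2 * d))).
  by rewrite -natrM -natrX ler_nat.
apply: (@le_trans _ _ (y ^+ (2 * d))).
  by rewrite ler_pXn2r ?nnegrE ?(ltW y0) ?muln_gt0// natrM.
by rewrite ler_weXn2l ?leq_mul//; lra.
Qed.

Lemma expR_3half_le (R : realType) : expR (3 / 2 : R) <= 8.
Proof.
have -> : expR (3 / 2 : R) = expR (1 / 4) ^+ 6.
  by rewrite -expRM_natl; congr expR; lra.
have h : expR (1 / 4 : R) <= 21 / 16.
  by have := @expR_le_quadratic R (1 / 4); rewrite expr2; lra.
apply: (@le_trans _ _ ((21 / 16) ^+ 6)); last by rewrite !exprS expr0; lra.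
by rewrite ler_pXn2r ?nnegrE ?expR_ge0//; lra.
Qed.

Lemma ln_ge_3half (R : realType) (y : R) : 8 <= y -> 3 / 2 <= ln y.
Proof.
move=> y8; rewrite -[leLHS]expRK ler_ln ?posrE ?expR_gt0//; last by lra.
exact: le_trans (expR_3half_le R) y8.
Qed.

(* On the boundary of the cap the curvature lambda / K beats the three
   deviation terms of [bilin_deviation]. *)
Lemma cap_boundary (R : realType) (d : nat) (phi psi : 'I_d -> R) (e l : R) :
  norm2 phi = 1 -> norm2 psi = 1 -> norm2 (fun i => psi i - phi i) = e ->
  0 < e -> e <= 1 -> 0 < l -> (0 < d)%N ->
  let h := 1 - dotv psi phi ^+ 2 in
  h * (l / 8) + 2 * Num.sqrt h * Num.sqrt d%:R * (e * l / (4 * Num.sqrt d%:R))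
    + h * d%:R * (l / (8 * d%:R)) < l * h.
Proof.
move=> phi1 psi1 pe e0 e1 l0 d0; cbv zeta; set h := 1 - _.
have dR : (0 : R) < d%:R by rewrite ltr0n.
have sd : 0 < Num.sqrt d%:R :> R by rewrite sqrtr_gt0.
have dotE : dotv psi phi = 1 - e ^+ 2 / 2.
  have := sqr_norm2 (fun i => psi i - phi i).
  rewrite pe dotvBl !dotvBr -!sqr_norm2 phi1 psi1 (dotvC phi); lra.
have hE : h = e ^+ 2 * (1 - e ^+ 2 / 4) by rewrite /h dotE; field.
have e2 : e ^+ 2 <= 1 by rewrite expr_le1// ltW.
have e20 : 0 < e ^+ 2 by rewrite exprn_gt0.
have h0 : 0 < h by rewrite hE mulr_gt0//; lra.
pose s := Num.sqrt h.
have s0 : 0 < s by rewrite sqrtr_gt0.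
have hs : h = s ^+ 2 by rewrite sqr_sqrtr ?ltW.
(* Since [e <= 1], [h >= 3/4 e^2], and [9/4 * 3/4 > 1]. The mixed term then stays below [3/4 l h],
   and the other two contribute [1/8 l h] each. *)
have es : e < 3 / 2 * s.
  rewrite -(@ltr_pXn2r _ 2) ?nnegrE ?mulr_ge0 ?(ltW e0) ?(ltW s0)//.
  rewrite exprMn -hs hE mulrCA -[ltLHS]mulr1 ltr_pM2l//.
  by rewrite expr2; lra.
have -> : 2 * Num.sqrt h * Num.sqrt d%:R * (e * l / (4 * Num.sqrt d%:R)) =
    s * e * l / 2 by rewrite -/s; field; rewrite gt_eqF.
have -> : h * d%:R * (l / (8 * d%:R)) = h * l / 8 by field; rewrite gt_eqF.
rewrite hs.
have : s * l * e < s * l * (3 / 2 * s) by rewrite ltr_pM2l ?mulr_gt0.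
rewrite expr2; lra.
Qed.

(** Unit vectors in dimension one are 1 and -1, and the objective ignores signs. This settles
    [K = 1]. *)
Lemma Kobj_dim1 (R : realType) (K N : nat) (Y : 'I_N -> 'I_1 -> R)
    (Psi Psi' : 'I_K -> 'I_1 -> R) :
  in_dict Psi -> in_dict Psi' -> Kobj Y Psi = Kobj Y Psi'.
Proof.
have abs1 (Psi0 : 'I_K -> 'I_1 -> R) k y : in_dict Psi0 ->
    `|dotv (Psi0 k) y| = `|y ord0|.
  move=> /(_ k); rewrite /norm2 /dotv !big_ord_recl !big_ord0 !addr0 sqrtr_sqr.
  by rewrite normrM => ->; rewrite mul1r.
move=> P1 P1'; congr (_ * _); apply: eq_bigr => n _; congr (_ ^+ 2).
by rewrite /normInf; apply: eq_bigr => k _; rewrite !abs1.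
Qed.

Section Thresholds.
Context {R : realType} {d K : nat}.
Hypotheses (d0 : (0 < d)%N) (K0 : (0 < K)%N).
Variables (C lam p n : R).
Hypotheses (C1 : 1 <= C) (l0 : 0 < lam) (l1 : lam <= 1) (p0 : 0 < p)
  (p6 : p <= 1 / 6) (n0 : 0 <= n).
Let A : R := K%:R / d%:R.
Hypothesis A1 : 1 <= A.
(** Here [n] is the sample size, [p] stands for [N^(-q)], [l] is the curvature, and [X0] is the
    exponent that each Bernstein bound must reach. *)
Let e : R := 8 * p ^+ 2 / (Num.sqrt K%:R * C).
Let l : R := lam / K%:R.
Let X0 : R := n * p ^+ 4 * lam ^+ 2 / (4 * K%:R ^+ 2 * C ^+ 2).

Let Kp : 0 < K%:R :> R. Proof. by rewrite ltr0n. Qed.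
Let dp : 0 < d%:R :> R. Proof. by rewrite ltr0n. Qed.
Let sK : 0 < Num.sqrt K%:R :> R. Proof. by rewrite sqrtr_gt0. Qed.
Let sd : 0 < Num.sqrt d%:R :> R. Proof. by rewrite sqrtr_gt0. Qed.
Let sqrtE m : (0 < m)%N ->
  exists s : R, [/\ 0 < s, m%:R = s ^+ 2 & Num.sqrt m%:R = s].
Proof.
move=> m0; have mp : 0 < m%:R :> R by rewrite ltr0n.
by exists (Num.sqrt m%:R); rewrite sqr_sqrtr ?(ltW mp) ?sqrtr_gt0.
Qed.
Let Cp : 0 < C. Proof. exact: lt_le_trans ltr01 C1. Qed.
Let p2 : p ^+ 2 <= 1 / 36.
Proof.
have -> : 1 / 36 = (1 / 6) ^+ 2 :> R by field.
by rewrite ler_pXn2r ?nnegrE ?(ltW p0)//; lra.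
Qed.
Let p4 : p ^+ 4 <= 1 / 1296.
Proof.
have -> : p ^+ 4 = (p ^+ 2) ^+ 2 by rewrite -exprM.
have -> : 1 / 1296 = (1 / 36) ^+ 2 :> R by field.
by rewrite ler_pXn2r ?nnegrE ?sqr_ge0//; lra.
Qed.
Let X00 : 0 <= n * p ^+ 4 * lam ^+ 2 / (K%:R ^+ 2 * C ^+ 2).
Proof. by rewrite divr_ge0 ?mulr_ge0 ?exprn_ge0// ?ltW. Qed.

Lemma radius_gt0 : 0 < e.
Proof. by rewrite divr_gt0 ?mulr_gt0 ?exprn_gt0. Qed.

Lemma radius_le : e <= 8 * p ^+ 2.
Proof.
rewrite ler_pdivrMr ?mulr_gt0// -[leLHS]mulr1 ler_wpM2l ?mulr_ge0 ?(ltW p0)//.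
rewrite -[leLHS]mul1r ler_pM// -[leLHS]sqrtr1 ler_wsqrtr// (ler_nat _ 1).
exact: K0.
Qed.

Lemma radiusE : e * C * Num.sqrt K%:R = 8 * p ^+ 2.
Proof. by rewrite /e; field; rewrite !gt_eqF. Qed.

(** The variance [81 / (16 K)] is [(3/2)^2] times the bound [9 / (4 K)] on the mean [l + s]. The
    exponent equals [n l^2 K / 1296], and [p^4 <= 1/1296] absorbs the constant. *)
Lemma threshold_top :
  3 * (l / 8) * (3 / 2 * (3 / 2)) <= 81 / (16 * K%:R) /\
  X0 <= n * (l / 8) ^+ 2 / (4 * (81 / (16 * K%:R))).
Proof.
split.
  have -> : 3 * (l / 8) * (3 / 2 * (3 / 2)) = 27 / 32 * lam / K%:R.
    by rewrite /l; field; rewrite gt_eqF.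
  have -> : 81 / (16 * K%:R) = 81 / 16 / K%:R :> R by field; rewrite gt_eqF.
  by rewrite ler_pM2r ?invr_gt0//; have := l1; lra.
have -> : n * (l / 8) ^+ 2 / (4 * (81 / (16 * K%:R))) =
    n * lam ^+ 2 / K%:R ^+ 2 * (K%:R / 1296).
  by rewrite /l; field; rewrite gt_eqF.
have -> : X0 = n * lam ^+ 2 / K%:R ^+ 2 * (p ^+ 4 / (4 * C ^+ 2)).
  by rewrite /X0; field; rewrite !gt_eqF.
rewrite ler_wpM2l ?divr_ge0 ?mulr_ge0 ?exprn_ge0 ?(ltW l0)//.
have K1 : 1 <= K%:R :> R by rewrite (ler_nat _ 1).
have C21 : 1 <= C ^+ 2 by rewrite expr_ge1// ltW.
rewrite ler_pdivrMr ?mulr_gt0 ?exprn_gt0//.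
have : 1 * 1 <= K%:R * C ^+ 2 by rewrite ler_pM.
move: p4; lra.
Qed.

(** The critical entries, with tolerance proportional to [e]. The variance [3 A / K^2] exceeds
    [(3/2)^2 * 5/4 * A / K^2]. As [A d = K], the dimension cancels and the exponent is [4/3] of
    [X0]; this is what the 8 in [e] provides for. *)
Lemma threshold_mixed :
  3 * (e * l / (4 * Num.sqrt d%:R)) * (3 / 2 * C) <= 3 * A / K%:R ^+ 2 /\
  X0 <= n * (e * l / (4 * Num.sqrt d%:R)) ^+ 2 / (4 * (3 * A / K%:R ^+ 2)).
Proof.
have sA : Num.sqrt A = Num.sqrt K%:R / Num.sqrt d%:R by rewrite sqrtrM ?sqrtrV ?ltW.
split.
  have -> : 3 * (e * l / (4 * Num.sqrt d%:R)) * (3 / 2 * C) =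
      9 * p ^+ 2 * lam * Num.sqrt A / K%:R ^+ 2.
    rewrite sA /e /l; have [k [k0 kE ->]] := sqrtE K0; rewrite kE.
    by field; rewrite !gt_eqF.
  rewrite ler_pM2r ?invr_gt0 ?exprn_gt0//.
  have sA1 : Num.sqrt A <= A.
    rewrite -{2}[A]sqr_sqrtr ?(le_trans _ A1)// expr2 ler_peMl ?sqrtr_ge0//.
    by rewrite -[leLHS]sqrtr1 ler_wsqrtr.
  have pl0 : 0 <= p ^+ 2 * lam by rewrite mulr_ge0 ?sqr_ge0 ?(ltW l0).
  have pl : p ^+ 2 * lam <= 1 / 36 * 1 by rewrite ler_pM ?sqr_ge0 ?(ltW l0).
  by apply: ler_pM => //; rewrite ?sqrtr_ge0 -?mulrA; lra.
have -> : n * (e * l / (4 * Num.sqrt d%:R)) ^+ 2 / (4 * (3 * A / K%:R ^+ 2)) =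
    n * p ^+ 4 * lam ^+ 2 / (K%:R ^+ 2 * C ^+ 2) * (1 / 3).
  rewrite /e /l /A; have [k [k0 kE ->]] := sqrtE K0; rewrite kE.
  have [s [s0 sE ->]] := sqrtE d0; rewrite sE.
  by field; rewrite !gt_eqF.
have -> : X0 = n * p ^+ 4 * lam ^+ 2 / (K%:R ^+ 2 * C ^+ 2) * (1 / 4).
  by rewrite /X0; field; rewrite !gt_eqF.
by rewrite ler_wpM2l//; lra.
Qed.

(** Both factors are bounded only by [C], hence [C^2] in the variance; the tolerance does not
    involve [e], so [A >= 1] and the smallness of [p^4] suffice. *)
Lemma threshold_perp :
  3 * (l / (8 * d%:R)) * (C * C) <= 5 / 4 * C ^+ 2 * A / K%:R ^+ 2 /\
  X0 <= n * (l / (8 * d%:R)) ^+ 2 / (4 * (5 / 4 * C ^+ 2 * A / K%:R ^+ 2)).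
Proof.
have Ap : 0 < A := lt_le_trans ltr01 A1.
split.
  have -> : 3 * (l / (8 * d%:R)) * (C * C) =
      C ^+ 2 * A / K%:R ^+ 2 * (3 / 8 * lam).
    by rewrite /l /A; field; rewrite !gt_eqF.
  have -> : 5 / 4 * C ^+ 2 * A / K%:R ^+ 2 = C ^+ 2 * A / K%:R ^+ 2 * (5 / 4).
    by ring.
  have CA : 0 <= C ^+ 2 * A / K%:R ^+ 2.
    by rewrite divr_ge0 ?sqr_ge0// mulr_ge0 ?sqr_ge0// ltW.
  by rewrite ler_wpM2l//; have := l1; lra.
have -> : n * (l / (8 * d%:R)) ^+ 2 / (4 * (5 / 4 * C ^+ 2 * A / K%:R ^+ 2)) =
    n * lam ^+ 2 / (K%:R ^+ 2 * C ^+ 2) * (A / 320).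
  by rewrite /l /A; field; rewrite !gt_eqF.
have -> : X0 = n * lam ^+ 2 / (K%:R ^+ 2 * C ^+ 2) * (p ^+ 4 / 4).
  by rewrite /X0; field; rewrite !gt_eqF.
have nl : 0 <= n * lam ^+ 2 / (K%:R ^+ 2 * C ^+ 2).
  by rewrite divr_ge0// mulr_ge0// sqr_ge0.
rewrite ler_wpM2l//; have := p4; have := A1; lra.
Qed.

End Thresholds.

Lemma powR_sample_size (R : realType) (N : nat) (q : R) : (0 < N)%N ->
  N%:R `^ (1 - 4 * q) = N%:R * (N%:R `^ (- q)) ^+ 4.
Proof.
move=> N0; have N0' : (N%:R : R) != 0 by rewrite pnatr_eq0 -lt0n.
have -> : 1 - 4 * q = 1 + (- q) * 4 by ring.
rewrite powRD; last by rewrite N0' implybT.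
by rewrite powRr1// powRrM (powR_mulrn 4)// powR_ge0.
Qed.

Lemma top_productC (R : realType) (d K : nat) (Phi : 'I_K -> 'I_d -> R)
    (rho_max beta : R) k u v :
  top_product Phi rho_max beta k u v = top_product Phi rho_max beta k v u.
Proof. by apply/funext => z; rewrite /top_product; congr (_ * _); rewrite mulrC. Qed.

(** * Recovery for a fixed sample with small deviations *)

Section FiniteSample.
Context {R : realType} {d K N : nat} (Phi : 'I_K -> 'I_d -> R).
Variables (rho_max beta : R) (x : 'I_N -> K.-tuple R) (r : 'I_N -> d.-tuple R).

(** [None] is the atom itself, so [option 'I_d] indexes all [d + 1] directions and one finite type
    enumerates the events of the union bound. *)
Definition direction (k : 'I_K) (o : option 'I_d) : 'I_d -> R :=
  if o is Some a then perp_basis (Phi k) a else Phi k.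

Definition threshold (e l : R) (o1 o2 : option 'I_d) : R :=
  match o1, o2 with
  | None, None => l / 8
  | Some _, Some _ => l / (8 * d%:R)
  | _, _ => e * l / (4 * Num.sqrt d%:R)
  end.

Definition mean_form (l s : R) (k : 'I_K) (u v : 'I_d -> R) : R :=
  l * (dotv u (Phi k) * dotv v (Phi k)) + s * dotv u v.

Lemma local_max_of_deviation (A e l s : R) :
  (0 < d)%N -> (0 < N)%N -> 0 <= A -> unit_norm_tight_frame Phi A ->
  beta < 1 / 2 -> 0 < e -> e <= 1 -> 0 < l ->
  3 * e * (Num.sqrt A + rho_max) * Num.sqrt K%:R <= 1 - 2 * beta ->
  (forall n, exists k, gap_set (coherence Phi) rho_max beta k (x n)) ->
  (forall n, noise_ball rho_max (r n)) ->
  (forall k o1 o2,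
    `|N%:R^-1 * \sum_n top_product Phi rho_max beta k
        (direction k o1) (direction k o2) (x n, r n)
      - mean_form l s k (direction k o1) (direction k o2)|
    <= threshold e l o1 o2) ->
  exists Psi, local_max_dict (fun n => signal Phi (tvec (x n)) (tvec (r n))) Psi
    /\ dict_dist Psi Phi <= e.
Proof.
move=> d0 N0 A0 frame b e0 e1 l0 stab /choice[lab labP] rb dev.
have [P1 _] := frame.
pose Y n := signal Phi (tvec (x n)) (tvec (r n)).
have NR : 0 < N%:R :> R by rewrite ltr0n.
have tpE k u v n : top_product Phi rho_max beta k u v (x n, r n) =
    (lab n == k)%:R * (dotv u (Y n) * dotv v (Y n)).
  rewrite /top_product /= !indicE [r n \in _]mem_set; last exact: rb.
  rewrite mulr1; congr ((nat_of_bool _)%:R * _).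
  apply/idP/eqP => [/set_mem gk|<-]; last exact/mem_set.
  exact: gap_set_disj (labP n) gk.
apply: (@local_max_of_stable R d K N Y Phi lab e) => //.
  move=> Psi _ Pe n; have [x1 g] := labP n.
  exact: (argmax_stable A0 frame g x1 (rb n) b (ltW e0) stab Pe).
move=> k psi psi1 pe.
pose D u v := N%:R^-1 * \sum_n (lab n == k)%:R * (dotv u (Y n) * dotv v (Y n))
              - mean_form l s k u v.
have Dlin a u v w : D (fun i => a * u i + v i) w = a * D u w + D v w.
  rewrite /D /mean_form !(dotvDl, dotvZl).
  have -> : \sum_n (lab n == k)%:R *
      (dotv (fun i => a * u i + v i) (Y n) * dotv w (Y n)) =
    a * (\sum_n (lab n == k)%:R * (dotv u (Y n) * dotv w (Y n))) +
    \sum_n (lab n == k)%:R * (dotv v (Y n) * dotv w (Y n)).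
    rewrite mulr_sumr -big_split /=; apply: eq_bigr => n _.
    by rewrite dotvDl dotvZl; ring.
  by ring.
have Dsym u v : D u v = D v u.
  rewrite /D /mean_form (dotvC u v) [X in l * X]mulrC; congr (_ * _ - _).
  by apply: eq_bigr => n _; rewrite [X in _ * X]mulrC.
have DE o1 o2 : `|D (direction k o1) (direction k o2)| <= threshold e l o1 o2.
  rewrite /D; under eq_bigr do rewrite -tpE; exact: dev.
have dp : 0 < d%:R :> R by rewrite ltr0n.
have t10 : 0 <= e * l / (4 * Num.sqrt d%:R).
  by rewrite divr_ge0 ?mulr_ge0 ?sqrtr_ge0 ?(ltW e0) ?(ltW l0).
have t20 : 0 <= l / (8 * d%:R) by rewrite divr_ge0 ?(ltW l0).
have := bilin_deviation Dlin Dsym (P1 k) psi1 t10 t20 (DE None None)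
  (fun a => DE None (Some a)) (fun a b => DE (Some a) (Some b)).
move=> /= dev'; have := le_lt_trans dev' (cap_boundary (P1 k) psi1 pe e0 e1 l0 d0).
(* For unit vectors the [s] part of the mean form cancels and the rank-one part drops by exactly
   [l h], the right-hand side of the deviation bound. *)
rewrite /D /mean_form -!sqr_norm2 psi1 P1 !expr1n.
set Sp := \sum_n _; set Sf := \sum_n _ => H.
have : N%:R^-1 * Sp < N%:R^-1 * Sf by move: H; lra.
by rewrite ltr_pM2l ?invr_gt0// /Sp /Sf.
Qed.

End FiniteSample.

(** * Exceptional event and local maximum for random samples *)

Theorem theorem7 (R : realType) (d K N : nat) (Phi : 'I_K -> 'I_d -> R)
  (d0 : measure_display) (Omega : measurableType d0) (P : probability Omega R)
  (X : 'I_N -> {RV P >-> K.-tuple R}) (Rn : 'I_N -> {RV P >-> d.-tuple R})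
  (nu : probability (K.-tuple R) R)
  (rho rho_max c1bar beta q : R) :
  (0 < d)%N -> (0 < N)%N ->
  let A := K%:R / d%:R in
  let mu := coherence Phi in
  unit_norm_tight_frame Phi A ->
  (* the pairs (x_n, r_n) are i.i.d., and r_n is independent of x_n *)
  mutually_indep P (fun n w => (X n w, Rn n w)) ->
  ident_distr P (fun n w => (X n w, Rn n w)) ->
  (forall n, indep2 P (X n) (Rn n)) ->
  (* noise: bounded a.s., centred, covariance rho^2 I *)
  (forall n, P [set w | norm2 (tvec (Rn n w)) <= rho_max] = 1%E) ->
  (forall n i, ('E_P[fun w => tnth (Rn n w) i] = 0)%E) ->
  (forall n i j, ('E_P[fun w => (tnth (Rn n w) i * tnth (Rn n w) j)%R]
                 = (if i == j then rho ^+ 2 else 0)%:E)%E) ->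
  (* coefficients: x_n ~ nu, nu a symmetric probability on the sphere S^{K-1} *)
  (forall n B, measurable B -> P (X n @^-1` B) = nu B) ->
  nu [set x | norm2 (tvec x) = 1] = 1%E ->
  symmetric_measure nu ->
  (\int[nu]_x ((normInf (tvec x)) ^+ 2)%:E = (c1bar ^+ 2)%:E)%E ->
  beta < 1 / 2 ->
  nu [set x | 0 < cc 1 (tvec x) - cc 2 (tvec x) /\
              (cc 2 (tvec x) + mu * cnorm1 (tvec x) + rho_max)
                / (cc 1 (tvec x) - cc 2 (tvec x)) <= beta] = 1%E ->
  let lambda := c1bar ^+ 2 - (1 - c1bar ^+ 2) / (K%:R - 1) in
  let C_L := (Num.sqrt A + rho_max) ^+ 2 in
  0 < q -> q < 1 / 4 ->
  N%:R `^ (- q) + N%:R `^ (- (2 * q)) / K%:R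
    <= (1 - 2 * beta) ^+ 2 / (4 * A * ln (4 * A * K%:R / lambda)) ->
  exists2 B : set Omega,
    measurable B /\
    (P B <= (expR (- (N%:R `^ (1 - 4 * q) * lambda ^+ 2) / (4 * K%:R ^+ 2 * C_L)
                  + K%:R * d%:R * ln (N%:R * K%:R * C_L / lambda)))%:E)%E &
    forall w, ~ B w ->
      exists Psi : 'I_K -> 'I_d -> R,
        local_max_dict
          (fun (n : 'I_N) (i : 'I_d) =>
             \sum_(k < K) tnth (X n w) k * Phi k i + tnth (Rn n w) i) Psi
        /\ dict_dist Psi Phi <= 2 * N%:R `^ (- q).
Proof.
move=> dpos Npos A mu frame ind _ indXR Rb Rm Rc Xl nu1 sym nuc1 b nucc lambda
  C_L q0 q4 HN.
have [P1 _] := frame.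
(* For [K = 0] the unit sphere is empty and could not have measure one. *)
have Kpos : (0 < K)%N.
  rewrite lt0n; apply/eqP => K0; have [x] := prob1_nonempty nu1.
  rewrite /= /norm2 big1 ?sqrtr0; first by move/eqP; rewrite eq_sym oner_eq0.
  by move=> [i iK]; exfalso; move: iK; rewrite K0.
have A1 : 1 <= A by exact: frame_constant_ge1 frame.
have dp : 0 < d%:R :> R by rewrite ltr0n.
have Kp : 0 < K%:R :> R by rewrite ltr0n.
have Np : 0 < N%:R :> R by rewrite ltr0n.
pose p := N%:R `^ (- q).
have p0 : 0 < p by exact: powR_gt0.
(* If [K = 1], then [A >= 1] forces [d = 1], the objective is constant on dictionaries, and [Phi]
   itself is a local maximum with no exceptional event. *)
have [Kle1|K1] := leqP K 1.
  have d1 : d = 1%N.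
    have K1 : K = 1%N by apply/eqP; rewrite eqn_leq Kle1.
    move: A1; rewrite /A K1 ler_pdivlMr// mul1r (ler_nat _ d 1) => d1.
    by apply/eqP; rewrite eqn_leq d1.
  exists set0; first by split => //; rewrite measure0 lee_fin expR_ge0.
  move=> w _; exists Phi; split.
    split=> //; exists 1 => // Psi' P1' _.
    by subst d; rewrite (Kobj_dim1 _ P1 P1').
  apply/dict_dist_le; first by rewrite mulr_ge0 ?powR_ge0.
  by move=> k; rewrite norm2_subxx mulr_ge0 ?powR_ge0.
pose n0 := Ordinal Npos.
have rho0 : 0 <= rho_max.
  by have [w] := prob1_nonempty (Rb n0); apply: le_trans; exact: norm2_ge0.
have mu0 : 0 <= mu by exact: coherence_ge0.
pose gset := @gap_set R K mu rho_max beta.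
have gapE : \bigcup_k gset k = [set x | norm2 (tvec x) = 1] `&`
    \bigcup_k [set x | gapped mu rho_max beta (tvec x) k].
  apply/seteqP; split => [x [k _ [x1 g]]|x [x1 [k _ g]]].
    by split=> //; exists k.
  by exists k.
have mgap : measurable (\bigcup_k [set x : K.-tuple R | gapped mu rho_max beta (tvec x) k]).
  by apply: fin_bigcup_measurable => // k _; exact: measurable_gapped.
have gapU : nu (\bigcup_k gset k) = 1%E.
  rewrite gapE; apply: prob1_setI => //; first exact: measurable_unit_sphere.
  rewrite -[RHS]nucc; congr (nu _); apply/seteqP; split => x.
    by move=> [k _ g]; apply/(cc_gapP _ _ K1 mu0 rho0); exists k.
  by move=> /(cc_gapP _ _ K1 mu0 rho0) [k g]; exists k.
have mgU : measurable (\bigcup_k gset k).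
  by rewrite gapE; apply: measurableI => //; exact: measurable_unit_sphere.
have [tau0 tauK lam0 lam1] := spectral_gap_bounds K1 sym mu0 rho0 b gapU nuc1.
rewrite -/lambda in lam0 lam1; set tau := (1 - _) / _ in tau0 tauK.
(* A single gapped unit vector suffices: [rho_max <= beta (|x_k| - |x_j|) <= 1/2]. *)
have [b0 rho12] : 0 <= beta /\ rho_max <= 1 / 2.
  have [x [k _ [x1 g]]] := prob1_nonempty gapU.
  have [j jk] : exists j : 'I_K, j != k.
    have [k0|k0] := eqVneq k (Ordinal Kpos).
      by exists (Ordinal K1); rewrite k0.
    by exists (Ordinal Kpos); rewrite eq_sym.
  have [lt H] := g j jk.
  have S0 : 0 <= mu * \sum_i `|tvec x i| by rewrite mulr_ge0 ?sumr_ge0.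
  have xk : `|tvec x k| <= 1 by rewrite -x1 abs_coord_le.
  have xj := normr_ge0 (tvec x j).
  have dif : 0 < `|tvec x k| - `|tvec x j| by rewrite subr_gt0.
  have b0 : 0 <= beta.
    by rewrite -(pmulr_lge0 _ dif); apply: le_trans H; rewrite !addr_ge0.
  split=> //.
  have : beta * (`|tvec x k| - `|tvec x j|) <= 1 / 2 * 1.
    by apply: ler_pM => //; lra.
  lra.
pose C := Num.sqrt A + rho_max.
have A0 : 0 <= A by lra.
have C1 : 1 <= C.
  have : 1 <= Num.sqrt A by rewrite -[leLHS]sqrtr1 ler_wsqrtr.
  by rewrite /C; lra.
(* The argument of the logarithm is at least 8, so the logarithm is at least [3/2]; together with
   [A >= 1] the denominator is at least 6. *)
have p6 : p <= (1 - 2 * beta) ^+ 2 / 6.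
  have L : 3 / 2 <= ln (4 * A * K%:R / lambda).
    apply: ln_ge_3half; rewrite ler_pdivlMr//.
    have K2 : 2 <= K%:R :> R by rewrite (ler_nat _ 2).
    have : 1 * 2 <= A * K%:R by rewrite ler_pM.
    lra.
  have AL : 1 * (3 / 2) <= A * ln (4 * A * K%:R / lambda) by rewrite ler_pM.
  have : p <= (1 - 2 * beta) ^+ 2 / (4 * A * ln (4 * A * K%:R / lambda)).
    by apply: le_trans HN; rewrite lerDl divr_ge0 ?powR_ge0.
  move=> /le_trans; apply; rewrite ler_wpM2l ?sqr_ge0// lef_pV2 ?posrE//; lra.
have bb : (1 - 2 * beta) ^+ 2 <= 1 by rewrite expr_le1//; lra.
have p6' : p <= 1 / 6 by lra.
pose e := 8 * p ^+ 2 / (Num.sqrt K%:R * C).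
pose l := lambda / K%:R.
have l0 : 0 < l by rewrite divr_gt0.
pose s := @sigma_of R K A rho c1bar.
have e0 : 0 < e by exact: radius_gt0.
have ele : e <= 8 * p ^+ 2 by exact: radius_le.
have p2 : p ^+ 2 <= p * (1 / 6) by rewrite expr2 ler_wpM2l// ltW.
have e1 : e <= 1 by lra.
have e2p : e <= 2 * p by lra.
have stab : 3 * e * (Num.sqrt A + rho_max) * Num.sqrt K%:R <= 1 - 2 * beta.
  have -> : 3 * e * (Num.sqrt A + rho_max) * Num.sqrt K%:R = 24 * p ^+ 2.
    rewrite -/C -mulrA -mulrA [e * _]mulrA radiusE//; first by ring.
  have : p ^+ 2 <= (1 / 6) * ((1 - 2 * beta) ^+ 2 / 6).
    by rewrite expr2 ler_pM// ltW.
  have : (1 - 2 * beta) ^+ 2 <= (1 - 2 * beta) * 1.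
    by rewrite expr2 ler_wpM2l//; lra.
  lra.
have mZ n : measurable_fun setT (fun w => (X n w, Rn n w)).
  by apply/measurable_fun_pair; exact: measurable_funP.
have mX n : measurable_fun setT (X n) by exact: measurable_funP.
have mR n : measurable_fun setT (Rn n) by exact: measurable_funP.
have mean n k u v : \int[P]_w top_product Phi rho_max beta k u v (X n w, Rn n w) =
    mean_form Phi l s k u v.
  exact: (top_product_mean K1 (mX n) (mR n) frame (indXR n) (Rb n) (Rm n)
    (Rc n) (Xl n) sym gapU nuc1).
have rhod : d%:R * rho ^+ 2 <= rho_max ^+ 2.
  exact: (noise_variance_le (mR n0) (Rb n0) (Rc n0)).
have AE : A = K%:R / d%:R by [].
(* [tau <= 1/K] contributes [A / K^2]; the noise contributes a quarter of that, since [rho^2 <=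
   rho_max^2 / d <= 1 / (4 d) = A / (4 K)]. *)
have sle : s <= 5 / 4 * A / K%:R ^+ 2.
  have r2 : rho ^+ 2 <= A / (4 * K%:R).
    have -> : A / (4 * K%:R) = (1 / 4) / d%:R.
      by rewrite AE; field; rewrite !gt_eqF.
    rewrite ler_pdivlMr// mulrC; apply: le_trans rhod _.
    have -> : 1 / 4 = (1 / 2) ^+ 2 :> R by field.
    by rewrite ler_pXn2r ?nnegrE.
  have tA : tau * A <= K%:R^-1 * A by rewrite ler_wpM2r.
  rewrite /s /sigma_of -/tau.
  have -> : 5 / 4 * A / K%:R ^+ 2 = (K%:R^-1 * A + A / (4 * K%:R)) / K%:R.
    by field; rewrite gt_eqF.
  by rewrite ler_pM2r ?invr_gt0// lerD.
have s0 : 0 <= s.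
  by rewrite /s /sigma_of -/tau divr_ge0 ?addr_ge0 ?sqr_ge0// mulr_ge0.
pose X0 := N%:R * p ^+ 4 * lambda ^+ 2 / (4 * K%:R ^+ 2 * C ^+ 2).
(* Template for all entries: the first direction enters through its sup bound [M], the second
   through its second moment. *)
have ev k u v (M L t vv : R) : 0 <= M -> 0 <= L ->
    (forall x r, gset k x -> noise_ball rho_max r ->
      `|dotv u (signal Phi (tvec x) (tvec r))| <= M /\
      `|dotv v (signal Phi (tvec x) (tvec r))| <= L) ->
    M ^+ 2 * mean_form Phi l s k v v <= vv ->
    0 < t -> 0 < vv -> 3 * t * (M * L) <= vv -> X0 <= N%:R * t ^+ 2 / (4 * vv) ->
    let E := [set w | t <= `|N%:R^-1 * \sum_n
        top_product Phi rho_max beta k u v (X n w, Rn n w) - mean_form Phi l s k u v|] in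
    measurable E /\ (P E <= (2 * expR (- X0))%:E)%E.
  move=> M0 L0 bnd Mv t0 vv0 tb tX E.
  have TB := top_product_bound M0 L0 bnd.
  have TBv : exists M', forall z, `|top_product Phi rho_max beta k v v z| <= M'.
    exists (L * L) => z; apply: (proj1 (top_product_bound L0 L0 _ z)) => x r gx br.
    by have [] := bnd x r gx br.
  have bv n : bmeas (fun w => top_product Phi rho_max beta k v v (X n w, Rn n w)).
    apply: (bmeas_comp (f := top_product Phi rho_max beta k v v) (mZ n)).
    by split => //; exact: measurable_top_product.
  have bu n : bmeas (fun w => top_product Phi rho_max beta k u v (X n w, Rn n w)).
    apply: (bmeas_comp (f := top_product Phi rho_max beta k u v) (mZ n)).
    split; first exact: measurable_top_product.
    by exists (M * L) => z; have [] := TB z.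
  have [mE PE] := @bernstein R _ _ _ _ P N (fun n w => (X n w, Rn n w))
    (top_product Phi rho_max beta k u v) (mean_form Phi l s k u v) vv (M * L) t
    Npos mZ ind (@measurable_top_product R d K Phi rho_max beta k u v)
    (fun z => proj1 (TB z)) (fun n => mean n k u v)
    (fun n => ltac:(
       apply: le_trans Mv; rewrite -(mean n) -RintZ//;
       apply: Rint_le; [exact: (bmeasM (bu n) (bu n))
         |exact: (bmeasM (bmeas_cst _) (bv n))
         |by move=> w; have [] := TB (X n w, Rn n w)])) t0 vv0 tb.
  split=> //; apply: le_trans PE _.
  by rewrite lee_fin ler_wpM2l// ler_expR lerN2.
have bphi k x r : gset k x -> noise_ball rho_max r ->
    `|dotv (Phi k) (signal Phi (tvec x) (tvec r))| <= 3 / 2.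
  by move=> [x1 g] br; exact: dotv_top_atom_le g x1 br b.
have bperp k a x r : gset k x -> noise_ball rho_max r ->
    `|dotv (perp_basis (Phi k) a) (signal Phi (tvec x) (tvec r))| <= C.
  move=> [x1 g] br; apply: le_trans (abs_dotv_le _ _) _.
  rewrite -[leRHS]mul1r ler_pM ?norm2_ge0// ?norm2_perp_basis//.
  exact: norm2_signal.
have mperp k a : mean_form Phi l s k (perp_basis (Phi k) a) (perp_basis (Phi k) a)
    <= 5 / 4 * A / K%:R ^+ 2.
  rewrite /mean_form perp_basis_orth// !mulr0 add0r dotvv_perp_basis//.
  apply: le_trans sle; rewrite -[leRHS]mulr1 ler_wpM2l// gerBl sqr_ge0 //.
have C0 : 0 <= C by lra.
have [th3 x3] : 3 * (l / 8) * (3 / 2 * (3 / 2)) <= 81 / (16 * K%:R) /\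
    X0 <= N%:R * (l / 8) ^+ 2 / (4 * (81 / (16 * K%:R))).
  by apply: threshold_top => //; exact: ltW.
have [th1 x1] :
    3 * (e * l / (4 * Num.sqrt d%:R)) * (3 / 2 * C) <= 3 * A / K%:R ^+ 2 /\
    X0 <= N%:R * (e * l / (4 * Num.sqrt d%:R)) ^+ 2 / (4 * (3 * A / K%:R ^+ 2)).
  by apply: threshold_mixed => //; exact: ltW.
have [th2 x2] :
    3 * (l / (8 * d%:R)) * (C * C) <= 5 / 4 * C ^+ 2 * A / K%:R ^+ 2 /\
    X0 <= N%:R * (l / (8 * d%:R)) ^+ 2 / (4 * (5 / 4 * C ^+ 2 * A / K%:R ^+ 2)).
  by apply: threshold_perp => //; exact: ltW.
have AK0 : 0 < A / K%:R ^+ 2 by rewrite divr_gt0 ?exprn_gt0//; lra.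
have sd0 : 0 < Num.sqrt d%:R :> R by rewrite sqrtr_gt0.
pose bad (i : 'I_K * (option 'I_d * option 'I_d)) := [set w |
  threshold e l i.2.1 i.2.2 <= `|N%:R^-1 * \sum_n
    top_product Phi rho_max beta i.1 (direction Phi i.1 i.2.1)
      (direction Phi i.1 i.2.2) (X n w, Rn n w)
    - mean_form Phi l s i.1 (direction Phi i.1 i.2.1) (direction Phi i.1 i.2.2)|].
have t10 : 0 < e * l / (4 * Num.sqrt d%:R).
  by apply: divr_gt0; apply: mulr_gt0.
have mixed k a : let E := [set w | e * l / (4 * Num.sqrt d%:R) <= `|N%:R^-1 * \sum_n
      top_product Phi rho_max beta k (Phi k) (perp_basis (Phi k) a) (X n w, Rn n w)
      - mean_form Phi l s k (Phi k) (perp_basis (Phi k) a)|] in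
    measurable E /\ (P E <= (2 * expR (- X0))%:E)%E.
  apply: (ev k _ _ (3 / 2) C _ (3 * A / K%:R ^+ 2)) => //.
  - by move=> x r gx br; split; [exact: bphi gx br|exact: bperp gx br].
  - have -> : (3 / 2) ^+ 2 = 9 / 4 :> R by field.
    have := mperp k a; rewrite -!(mulrA _ A).
    move: AK0 (mean_form _ _ _ _ _ _); move: (A / _) => y y0 m; lra.
  - by rewrite -mulrA; apply: mulr_gt0.
have badP i : measurable (bad i) /\ (P (bad i) <= (2 * expR (- X0))%:E)%E.
  case: i => k [[a|] [c|]] /=.
  - apply: (ev k _ _ C C _ (5 / 4 * C ^+ 2 * A / K%:R ^+ 2)) => //.
    + by move=> x r gx br; split; exact: bperp gx br.
    + have := ler_wpM2l (sqr_ge0 C) (mperp k c).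
      by move=> /le_trans; apply; rewrite le_eqVlt; apply/orP; left; apply/eqP; ring.
    + by apply: divr_gt0 => //; apply: mulr_gt0.
    + have -> : 5 / 4 * C ^+ 2 * A / K%:R ^+ 2 = 5 / 4 * (C ^+ 2 * (A / K%:R ^+ 2)).
        by ring.
      apply: mulr_gt0 => //; apply: mulr_gt0 => //.
      by rewrite exprn_gt0// (lt_le_trans ltr01 C1).
  (* By symmetry [phi_k] is moved to the first slot, so that the small second moment is the one
     along [perp_basis]. *)
  - have := mixed k a; rewrite /bad /= (top_productC Phi rho_max beta k (Phi k)).
    by rewrite /mean_form (dotvC (Phi k) (perp_basis _ _)) [X in l * X]mulrC.
  - exact: mixed.
  - apply: (ev k _ _ (3 / 2) (3 / 2) _ (81 / (16 * K%:R))) => //.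
    + by move=> x r gx br; split; exact: bphi gx br.
    + rewrite /mean_form -sqr_norm2 P1 expr1n !mulr1.
      have sK : s <= 5 / 4 / K%:R.
        apply: le_trans sle _.
        have -> : 5 / 4 * A / K%:R ^+ 2 = 5 / 4 / K%:R * (A / K%:R).
          by field; rewrite gt_eqF.
        rewrite -[leRHS]mulr1 ler_wpM2l ?divr_ge0 ?(ltW Kp)//.
        rewrite ler_pdivrMr// mul1r /A ler_pdivrMr// -[leLHS]mulr1 ler_wpM2l ?(ltW Kp)//.
        by rewrite (ler_nat _ 1).
      have lK : l <= 1 / K%:R by rewrite ler_pM2r ?invr_gt0.
      have -> : (3 / 2) ^+ 2 = 9 / 4 :> R by field.
      have -> : 81 / (16 * K%:R) = 81 / 16 / K%:R :> R by field; rewrite gt_eqF.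
      by move: sK lK; set z := K%:R^-1; lra.
    + by rewrite divr_gt0.
    + by rewrite divr_gt0 ?mulr_gt0.
have [mbad Pbad] := union_bound (fun i => proj1 (badP i)) (fun i => proj2 (badP i)).
pose good n := X n @^-1` (\bigcup_k gset k) `&` Rn n @^-1` noise_ball rho_max.
have mgood n : measurable (good n).
  apply: measurableI; rewrite -[Y in measurable Y]setTI; first exact: mX.
  by apply: mR => //; exact: measurable_noise_ball.
have Pgood n : P (good n) = 1%E.
  apply: prob1_setI.
  - by rewrite -[Y in measurable Y]setTI; exact: mX.
  - by rewrite -[Y in measurable Y]setTI; apply: mR => //; exact: measurable_noise_ball.
  - by rewrite Xl.
  - exact: Rb.
have [mng Png] : measurable (\bigcup_n ~` good n) /\
    (P (\bigcup_n ~` good n) <= (#|'I_N|%:R * 0)%:E)%E.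
  apply: union_bound => n; first exact: measurableC.
  by rewrite probability_setC// Pgood subee.
(* The first union is the null event that some sample violates the gap, the unit norm or the noise
   bound; off it the cutoffs in [top_product] only select the label. *)
exists (\bigcup_n ~` good n `|` \bigcup_i bad i).
  split; first exact: measurableU.
  apply: le_trans (measureU2 _ _ _) _ => //.
  have -> : expR (- (N%:R `^ (1 - 4 * q) * lambda ^+ 2) / (4 * K%:R ^+ 2 * C_L)
                  + K%:R * d%:R * ln (N%:R * K%:R * C_L / lambda)) =
      expR (- X0) * expR (K%:R * d%:R * ln (N%:R * K%:R * C_L / lambda)).
    by rewrite expRD powR_sample_size// -/p mulNr.
  apply: (@le_trans _ _ (0%:E + (#|{: 'I_K * (option 'I_d * option 'I_d)}|%:R *
      (2 * expR (- X0)))%:E)%E).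
    by apply: leeD; [move: Png; rewrite mulr0|exact: Pbad].
  rewrite add0e lee_fin !card_prod !card_option !card_ord mulrCA mulrA.
  rewrite [leLHS]mulrC ler_wpM2l ?expR_ge0//.
  apply: index_count => //.
  (* [N = 1] would give [p = 1], against [p <= 1/6]. With [C_L >= 1 >= lambda] the argument of the
     logarithm is then at least [2 K], as [index_count] requires. *)
  have N2 : 2 <= N%:R :> R.
    rewrite (ler_nat _ 2) ltnNge; apply/negP => N1.
    have N1' : N = 1%N by apply/eqP; rewrite eqn_leq N1.
    by move: p6'; rewrite /p N1' powR1; lra.
  have CL1 : 1 <= C_L by rewrite expr_ge1// -/C.
  have NK : 2 * K%:R <= N%:R * K%:R :> R by rewrite ler_pM2r.
  apply: le_trans NK _; rewrite ler_pdivlMr//.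
  by apply: ler_wpM2l; [rewrite mulr_ge0|exact: le_trans lam1 CL1].
move=> w nB.
have gw n : good n w.
  by apply: contrapT => ng; apply: nB; left; exists n.
have devw k o1 o2 : `|N%:R^-1 * \sum_n top_product Phi rho_max beta k
        (direction Phi k o1) (direction Phi k o2) (X n w, Rn n w)
      - mean_form Phi l s k (direction Phi k o1) (direction Phi k o2)|
    <= threshold e l o1 o2.
  rewrite leNgt; apply/negP => lt; apply: nB; right; exists (k, (o1, o2)) => //.
  exact: ltW.
have [Psi [lm dist]] := @local_max_of_deviation R d K N Phi rho_max beta
  (fun n => X n w) (fun n => Rn n w) A e l s dpos Npos A0 frame b e0 e1 l0 stab
  (fun n => ltac:(by have [[k _ gk] _] := gw n; exists k))
  (fun n => ltac:(by have [] := gw n)) devw.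
by exists Psi; split=> //; exact: le_trans dist e2p.
Qed.
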